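(* Let $T$ be the Terwilliger algebra, with respect to the identity permutation, of the conjugacy class association scheme of the symmetric group $\operatorname{Sym}(7)$. Then $\dim_{\mathbb{C}}(T) = 4039$ and the Wedderburn decomposition of $T$ is \begin{align*} T &= \operatorname{M}_{15}(\mathbb{C})\oplus\operatorname{M}_{15}(\mathbb{C})\oplus\operatorname{M}_{26}(\mathbb{C})\oplus\operatorname{M}_{2}(\mathbb{C})\oplus\operatorname{M}_{17}(\mathbb{C})\oplus\operatorname{M}_{16}(\mathbb{C})\oplus\operatorname{M}_{2}(\mathbb{C})\oplus\operatorname{M}_{21}(\mathbb{C})\\ &\quad\oplus\operatorname{M}_{15}(\mathbb{C})\oplus\operatorname{M}_{2}(\mathbb{C})\oplus\operatorname{M}_{19}(\mathbb{C})\oplus\operatorname{M}_{5}(\mathbb{C})\oplus\operatorname{M}_{13}(\mathbb{C})\oplus\operatorname{M}_{20}(\mathbb{C})\oplus\operatorname{M}_{8}(\mathbb{C})\oplus\operatorname{M}_{20}(\mathbb{C})\\ &\quad\oplus\operatorname{M}_{9}(\mathbb{C})\oplus\operatorname{M}_{4}(\mathbb{C})\oplus\operatorname{M}_{9}(\mathbb{C})\oplus\operatorname{M}_{3}(\mathbb{C})\oplus\operatorname{M}_{3}(\mathbb{C})\oplus\operatorname{M}_{7}(\mathbb{C})\oplus\operatorname{M}_{5}(\mathbb{C})\oplus\mathbb{C}. \end{align*}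
   Context: For a finite group $G$ with conjugacy classes $C_0=\{1\},C_1,\dots,C_d$, the conjugacy class scheme of $G$ is the association scheme on the set $G$ with relations $S_i=\{(x,y)\in G\times G : x^{-1}y\in C_i\}$, $0\le i\le d$. Let $A_i$ be the $0/1$ adjacency matrix of $S_i$ (rows and columns indexed by $G$), and let $E_i^*$ be the diagonal matrix, indexed by $G$, whose diagonal is the row of $A_i$ indexed by the identity $1\in G$ (so $(E_i^* )_{y,y}=1$ if $y\in C_i$ and $0$ otherwise). The Terwilliger algebra $T$ (with respect to $1$) is the $\mathbb{C}$-subalgebra of $\operatorname{M}_{|G|}(\mathbb{C})$ generated by $A_0,\dots,A_d,E_0^*,\dots,E_d^*$. It is semisimple. Equality of $T$ with a direct sum of full matrix algebras means isomorphism of $\mathbb{C}$-algebras. *)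

(* Defs.v *)
From mathcomp Require Import all_boot all_order all_algebra all_fingroup all_field.
From mathcomp Require Export reals complex.

Set Implicit Arguments.
Unset Strict Implicit.
Unset Printing Implicit Defensive.

Import GRing.Theory.
Local Open Scope ring_scope.

Section Terwilliger.

Variables (F : fieldType) (gT : finGroupType).

(* The library gives 'M_n a nontrivial ring (hence F-algebra) structure only  *)
(* when n is syntactically a successor, so |G| is written #|gT|.-1.+1.        *)
Fact card_predK : #|gT|.-1.+1 = #|gT|.
Proof. by rewrite prednK //; apply/card_gt0P; exists 1%g. Qed.

Local Notation idx := 'I_(#|gT|.-1.+1).
Local Notation mxG := 'M[F]_(#|gT|.-1.+1).

Definition elt_of (i : idx) : gT := enum_val (cast_ord card_predK i).

Definition idx_of (x : gT) : idx := cast_ord (esym card_predK) (enum_rank x).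

Lemma idx_ofK : cancel idx_of elt_of.
Proof. by move=> x; rewrite /elt_of /idx_of cast_ordKV enum_rankK. Qed.

Lemma elt_ofK : cancel elt_of idx_of.
Proof. by move=> i; rewrite /elt_of /idx_of enum_valK cast_ordK. Qed.

Definition class_rel (C : {set gT}) : rel gT :=
  fun x y => (x^-1 * y)%g \in C.

Definition class_adj (C : {set gT}) : mxG :=
  \matrix_(i, j) (class_rel C (elt_of i) (elt_of j))%:R.

Definition class_dual (C : {set gT}) : mxG :=
  diag_mx (row (idx_of 1%g) (class_adj C)).

Definition terwilliger_gens : seq mxG :=
  [seq class_adj C | C in classes [set: gT]]
    ++ [seq class_dual C | C in classes [set: gT]].

Definition terwilliger : {aspace mxG} := (<< <<terwilliger_gens>>%VS >>)%AS.

End Terwilliger.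

(* All the algebras in question are unital, so isomorphisms preserve 1. *)
Definition alg_isom (F : fieldType) (A B : algType F) : Prop :=
  exists f : {lrmorphism A -> B}, bijective f.

(* Main.v *)
From HB Require Import structures.
Require Import Defs.
From Stdlib Require Import ZArith.
From mathcomp Require Import all_boot all_order all_algebra all_fingroup all_field.
From mathcomp Require Import ssrZ.

Set Implicit Arguments.
Unset Strict Implicit.
Unset Printing Implicit Defensive.

Import GRing.Theory Num.Theory.
(* The ring libraries rebind the key Z to the scope of int. *)
Delimit Scope Z_scope with BZ.
Local Open Scope ring_scope.

(** Let G be Sym(7), A the adjacency matrix of the class of transpositions, and
    E_i the diagonal idempotents of the fifteen conjugacy classes.

    Upper bound.  The group H = G x C2 acts on G by conjugation and inversion,
    and all classes are closed under inversion, so the Terwilliger algebra T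
    lies in the algebra C of H-invariant matrices.  The dimension of C is the
    number of H-orbits on G x G, which is 4043, as one finds by counting fixed
    points ([card_pair_orbits], [card_orbits7]).  The simple summands of C
    correspond to the 25 characters (lambda, +) and (lambda, -) of H that occur
    in the permutation module.  Two of these, (4,3)^- and (4,1,1,1)^+, have
    multiplicity 2, and occur only in the classes of type (6,1) and (7); they
    are different over C but become isomorphic over T.  Indeed A acts on the
    two multiplicity spaces by the same matrix, of square 9, and the structure
    constants of the class algebra show that on a row space where A^2 = 9, the
    adjacency matrix of any class is a combination of 1 and A with coefficients
    that depend on the class only ([adj_central]).  Comparing the two actions
    gives four independent linear conditions on C that hold on T, and
    dim T <= 4039 ([dim_terwilliger_merged]).

    Lower bound. For each k of the 25 characters except (4,1,1,1)^+ there is an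
    integer matrix P_k, whose rows span the multiplicity space, with P_k A = M_k
    P_k; each row is supported on one class. T maps onto the product of the 24
    matrix algebras of the corresponding sizes ([blocks_onto]). The first row of
    P_k (the seed) is the only one in its class i, so E_i acts on block k as a
    matrix unit; the other rows are reached from the seed by A and the E_j, one
    at a time; the transposes of the words used give the columns, because the
    Gram matrix of P_k is invertible. It remains to separate the blocks: E_i A
    E_j A E_i acts on any block where E_i has rank at most one as a multiple of
    E_i, and for a well chosen class j the multiples differ. The blocks are
    treated in an order such that this suffices.

    The squares of the 24 sizes sum to 4039, so both bounds are sharp and
    T is the product of the 24 matrix algebras ([matrix_units_basis],
    [alg_isom_block_product]).  The numerical facts are integer computations
    on permutations written as words, done by evaluation. *)

(** * Algebras of matrices acting on several row spaces *)

Section Realize.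

Variables (F : fieldType) (N : nat) (T : {aspace 'M[F]_N.+1}).
Variables (K : finType) (m : K -> nat).
Variable P : forall k, 'M[F]_((m k).+1, N.+1).
Local Notation blocks := (forall k, 'M[F]_((m k).+1)).

(** The row spaces of the P k are modules over T acting on the right; y records
    the simultaneous action of x on all of them. *)
Definition realizes (x : 'M[F]_N.+1) (y : blocks) :=
  x \in T /\ forall k, P k *m x = y k *m P k.

Lemma realizesD x1 y1 x2 y2 :
  realizes x1 y1 -> realizes x2 y2 -> realizes (x1 + x2) (fun k => y1 k + y2 k).
Proof.
move=> [T1 e1] [T2 e2]; split=> [|k]; first exact: rpredD.
by rewrite mulmxDr mulmxDl e1 e2.
Qed.

Lemma realizesZ a x y : realizes x y -> realizes (a *: x) (fun k => a *: y k).
Proof.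
move=> [Tx e]; split=> [|k]; first exact: rpredZ.
by rewrite -scalemxAr -scalemxAl e.
Qed.

Lemma realizesM x1 y1 x2 y2 : realizes x1 y1 -> realizes x2 y2 ->
  realizes (x1 *m x2) (fun k => y1 k *m y2 k).
Proof.
move=> [T1 e1] [T2 e2]; split=> [|k]; first exact: (memvM T1 T2).
by rewrite mulmxA e1 -!mulmxA e2.
Qed.

Lemma realizes_sum (J : finType) x (y : J -> blocks) :
  (forall j, realizes (x j) (y j)) ->
  realizes (\sum_j x j) (fun k => \sum_j y j k).
Proof.
move=> r; split=> [|k]; first by apply: rpred_sum => j _; case: (r j).
by rewrite mulmx_sumr mulmx_suml; apply: eq_bigr => j _; case: (r j).
Qed.

Lemma realizes_ext x y1 y2 : (forall k, y1 k = y2 k) ->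
  realizes x y1 -> realizes x y2.
Proof. by move=> e [Tx r]; split=> // k; rewrite r e. Qed.

(** A rank one element t of block k, multiplied by the b r on the right and by
    their transposes on the left, yields all of block k: the left factors turn
    the seed column into the columns of the Gram matrix G, because
    y(b^T) G = G y(b)^T.  Blocks killed by t stay killed. *)
Lemma realizes_block (k : K) (t : 'M[F]_N.+1) (yt : blocks) c
    (b : 'I_(m k).+1 -> 'M[F]_N.+1) (yb yb' : 'I_(m k).+1 -> blocks) g z :
  realizes t yt -> yt k = c *: delta_mx 0 0 -> c != 0 ->
  (forall r, realizes (b r) (yb r)) -> (forall r, realizes (b r)^T (yb' r)) ->
  (forall r, row 0 (yb r k) = delta_mx 0 r) ->
  P k *m (P k)^T \in unitmx -> col 0 (P k *m (P k)^T) = g *: delta_mx 0 0 ->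
  exists x y, [/\ realizes x y, y k = z & forall l, yt l = 0 -> y l = 0].
Proof.
set G := P k *m (P k)^T => rt ytk c0 rb rb' row_b Gu colG.
have g0 : g != 0.
  apply/eqP => g0; move: colG; rewrite g0 scale0r => /(congr1 (mulmx (invmx G))).
  rewrite colE mulmxA mulVmx // mul1mx mulmx0 => /matrixP/(_ 0 0).
  by rewrite !mxE eqxx; apply/eqP/oner_neq0.
have colb r : yb' r k *m (delta_mx 0 0 : 'cV_(m k).+1) = g^-1 *: col r G.
  have ->: delta_mx 0 0 = g^-1 *: col 0 G :> 'cV_(m k).+1.
    by rewrite colG scalerA mulVf // scale1r.
  rewrite -scalemxAr !colE mulmxA; congr (_ *: _).
  have -> : yb' r k *m G = G *m (yb r k)^T.
    rewrite mulmxA; case: (rb' r) => _ /(_ k) <-; case: (rb r) => _ /(_ k) e.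
    by rewrite -mulmxA -trmx_mul e trmx_mul mulmxA.
  rewrite -mulmxA; congr (_ *m _).
  by rewrite -[delta_mx 0 0]trmxK trmx_delta -trmx_mul -rowE row_b trmx_delta.
pose a := (g / c) *: (invmx G *m z).
exists (\sum_r \sum_s a r s *: ((b r)^T *m t *m b s)).
exists (fun l => \sum_r \sum_s a r s *: (yb' r l *m yt l *m yb s l)); split.
- apply: (@realizes_sum _ _ (fun r l => \sum_s a r s *: (yb' r l *m yt l *m yb s l))) => r.
  apply: (@realizes_sum _ _ (fun s l => a r s *: (yb' r l *m yt l *m yb s l))) => s.
  by apply: realizesZ; apply: realizesM => //; apply: realizesM.
- transitivity ((c / g) *: (G *m a)); last first.
    rewrite /a -scalemxAr scalerA mulmxA mulmxV // mul1mx.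
    by rewrite mulrA divfK // divff // scale1r.
  rewrite [in RHS](matrix_sum_delta a) mulmx_sumr scaler_sumr.
  apply: eq_bigr => r _; rewrite mulmx_sumr scaler_sumr; apply: eq_bigr => s _.
  rewrite ytk -scalemxAr -!scalemxAl -scalemxAr !scalerA.
  rewrite -(mul_delta_mx (0 : 'I_1) r s) -(mul_delta_mx (0 : 'I_1) 0 0).
  rewrite !mulmxA colb -(colE r G) -mulmxA -rowE row_b -scalemxAl scalerA.
  by congr (_ *: _); rewrite [RHS]mulrC mulrA.
- move=> l y0; apply: big1 => r _; apply: big1 => s _.
  by rewrite y0 mulmx0 mul0mx scaler0.
Qed.

(** If each block can be filled at the cost of disturbing only the earlier ones,
    then all blocks can be prescribed at once, correcting from the last to the
    first. *)
Lemma realizes_triangular (s : seq K) : (forall k, k \in s) ->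
  (forall s1 k s2 z, s = s1 ++ k :: s2 ->
    exists x y, [/\ realizes x y, y k = z & {in s2, forall l, y l = 0}]) ->
  forall y, exists x, realizes x y.
Proof.
move=> all_s step y.
suff claim n : (n <= size s)%N -> forall y, {in drop n s, forall l, y l = 0} ->
    exists x, realizes x y.
  by apply: (claim (size s) (leqnn _)) => l; rewrite drop_size.
elim: n => [_ {}y|n IHn lt_n_s {}y y0].
  rewrite drop0 => y0; exists 0; split; first exact: mem0v.
  by move=> k; rewrite mulmx0 y0 ?mul0mx.
have k0 : K by case: (s) lt_n_s => [|k].
have ds : drop n s = nth k0 s n :: drop n.+1 s by apply: drop_nth.
set k := nth k0 s n in ds.
have [|x1 [y1 [r1 y1k y10]]] := step (take n s) k (drop n.+1 s) (y k).
  by rewrite -ds cat_take_drop.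
have [|x2 r2] := IHn (ltnW lt_n_s) (fun l => y l - y1 l).
  move=> l; rewrite ds inE => /orP[/eqP->|l_s]; first by rewrite y1k subrr.
  by rewrite y0 // y10 // subrr.
exists (x2 + x1).
by apply: realizes_ext (realizesD r2 r1) => l; rewrite subrK.
Qed.

End Realize.

(** * Surjectivity onto the blocks of seeded modules *)

Lemma rank1_sandwich (F : fieldType) n (i : 'I_n) (X : 'M[F]_n) :
  delta_mx i i *m X *m delta_mx i i = X i i *: delta_mx i i.
Proof.
rewrite -{1}(mul_delta_mx (0 : 'I_1) i i) -[in LHS](mul_delta_mx (0 : 'I_1) i i).
rewrite -!mulmxA (mulmxA X) -colE (mulmxA _ (col i X)) -rowE.
have ->: row i (col i X) = (X i i)%:M.
  by apply/matrixP => a b; rewrite !mxE !ord1 eqxx mulr1n.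
by rewrite mul_scalar_mx -scalemxAr mul_delta_mx.
Qed.

Section GradedModules.

Variables (F : fieldType) (N : nat) (T : {aspace 'M[F]_N.+1}).
Variables (I K : finType) (A : 'M[F]_N.+1) (E : I -> 'M[F]_N.+1).
Variables (m : K -> nat) (P : forall k, 'M[F]_((m k).+1, N.+1)).
Variables (M : forall k, 'M[F]_((m k).+1)) (cl : forall k, 'I_(m k).+1 -> I).

Definition class_proj k (i : I) : 'M[F]_((m k).+1) :=
  diag_mx (\row_r (@cl k r == i)%:R).
(** If r is the only row in its class i, then E_i A E_j A E_i acts on the module
    as this multiple of E_i. *)
Definition return_weight k (r : 'I_(m k).+1) (j : I) : F :=
  \sum_(q | @cl k q == j) M k r q * M k q r.

Hypotheses (T1 : 1%:M \in T) (TA : A \in T) (TE : forall i, E i \in T).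
Hypotheses (A_sym : A^T = A) (E_sym : forall i, (E i)^T = E i).
Hypothesis PA : forall k, P k *m A = M k *m P k.
Hypothesis PE : forall k i, P k *m E i = class_proj k i *m P k.
Hypothesis gram_unit : forall k, P k *m (P k)^T \in unitmx.
Hypothesis seed_alone : forall k r, @cl k r = @cl k 0 -> r = 0.
Hypothesis tree : forall k (r : 'I_(m k).+1), r != 0 ->
  exists s : 'I_(m k).+1, [/\ (s < r)%N, M k s r != 0 &
    forall q : 'I_(m k).+1, (r < q)%N -> @cl k q = @cl k r -> M k s q = 0].

Local Notation realizes := (realizes T P).

Let realA : realizes A M. Proof. by split. Qed.
Let realE i : realizes (E i) ((@class_proj)^~ i). Proof. by split. Qed.

Lemma class_proj_seed k : class_proj k (@cl k 0) = delta_mx 0 0.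
Proof.
apply/matrixP => r s; rewrite !mxE.
case: (eqVneq r s) => [<-|neq]; last first.
  by rewrite mulr0n; case: (r =P 0) neq => //= ->; case: (s =P 0) => // ->; rewrite eqxx.
by rewrite mulr1n andbb; congr (_%:R); congr nat_of_bool; apply/eqP/eqP => [/seed_alone|->].
Qed.

(** Rows in different classes are orthogonal, as the idempotents are symmetric. *)
Lemma gram_seed k : exists g, col 0 (P k *m (P k)^T) = g *: delta_mx 0 0.
Proof.
exists ((P k *m (P k)^T) 0 0); set G := P k *m _.
have DG : class_proj k (@cl k 0) *m G = G *m class_proj k (@cl k 0).
  rewrite mulmxA -PE -mulmxA -{1}E_sym -trmx_mul PE trmx_mul mulmxA.
  by rewrite [(class_proj _ _)^T]tr_diag_mx.
rewrite class_proj_seed in DG.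
rewrite colE -{1}(mul_delta_mx (0 : 'I_(m k).+1) 0 0) mulmxA -DG -mulmxA -colE.
apply/matrixP => i j; rewrite !mxE (bigD1 0) //= big1 => [|q q0]; rewrite !mxE ?addr0.
  by rewrite ord1 eqxx !andbT mulrC.
by rewrite (negPf q0) andbF mul0r.
Qed.

(** The vectors obtained from the seed by elements whose transposes are also
    under control. *)
Definition reachable k (v : 'rV[F]_(m k).+1) := exists b y y',
  [/\ realizes b y, realizes b^T y' & row 0 (y k) = v].

Lemma reachableD k u v : reachable u -> reachable v -> @reachable k (u + v).
Proof.
move=> [b1 [y1 [z1 [r1 s1 <-]]]] [b2 [y2 [z2 [r2 s2 <-]]]].
exists (b1 + b2); do 2!eexists; split; first exact: realizesD r1 r2.
  by rewrite linearD; apply: realizesD s1 s2.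
by rewrite linearD.
Qed.

Lemma reachableZ k a v : reachable v -> @reachable k (a *: v).
Proof.
move=> [b [y [z [r s <-]]]]; exists (a *: b); do 2!eexists; split.
- exact: realizesZ r.
- by rewrite linearZ; apply: realizesZ s.
by rewrite linearZ.
Qed.

Lemma reachable_step k v i : reachable v -> @reachable k (v *m M k *m class_proj k i).
Proof.
move=> [b [y [z [r s <-]]]]; exists (b *m A *m E i); do 2!eexists; split.
- exact: realizesM (realizesM r realA) (realE i).
- rewrite !trmx_mul E_sym A_sym.
  exact: realizesM (realE i) (realizesM realA s).
by rewrite /= !row_mul.
Qed.

(** Row s of M, restricted to the class of r, ends in column r; so A and the
    idempotent of that class carry row s to row r, up to rows reached before. *)
Lemma reachable_delta k r : @reachable k (delta_mx 0 r).
Proof.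
have [n] := ubnP (r : nat); elim: n => // n IHn in r *; rewrite ltnS => le_rn.
have [->|r0] := eqVneq r 0.
  have r1 : realizes 1%:M (fun=> 1%:M) by split=> // l; rewrite mulmx1 mul1mx.
  exists 1%:M; do 2!eexists; split; [exact: r1 | rewrite trmx1; exact: r1 |].
  by rewrite rowE mulmx1.
have [s [lt_sr Msr Ms0]] := tree r0.
have -> : (delta_mx 0 r : 'rV_(m k).+1) = (M k s r)^-1 *: (delta_mx 0 s *m M k *m
  class_proj k (@cl k r)
    + \sum_(q : 'I_(m k).+1 | (q < r)%N && (@cl k q == @cl k r)) (- M k s q) *: delta_mx 0
      q).
  rewrite -[LHS]scale1r -(mulVf Msr) -scalerA; apply: (congr1 ( *:%R _)); rewrite -rowE.
  apply/rowP => q; rewrite mul_mx_diag !mxE !eqxx summxE /=.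
  have -> : \sum_(i < (m k).+1 | (i < r)%N && (@cl k i == @cl k r))
      (- M k s i *: (delta_mx 0 i : 'rV_(m k).+1)) 0 q
    = - (((q < r)%N && (@cl k q == @cl k r))%:R * M k s q).
    rewrite (big_mkcond _ (fun i => _)) (bigD1 q) //= big1 => [|i neq]; last first.
      by rewrite !mxE (eq_sym q i) (negPf neq) andbF mulr0 if_same.
    by rewrite !mxE !eqxx /= mulr1 addr0; case: ifP; rewrite ?mul1r ?mul0r ?oppr0.
  have [->|neq] := eqVneq q r; first by rewrite ltnn eqxx /= mul0r oppr0 addr0.
  rewrite /= mulr0; have [lt_qr|] := ltnP q r; first by rewrite mulrC subrr.
  rewrite leq_eqVlt eq_sym -val_eqE in neq *; rewrite (negPf neq) /= => lt_rq.
  by case: eqP => [/Ms0->//|_]; rewrite !(mul0r, mulr0, subr0).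
apply/reachableZ/reachableD; first exact/reachable_step/IHn/(leq_trans lt_sr).
elim/big_ind: _ => [||q /andP[lt_qr _]].
- by rewrite -(scale0r (delta_mx 0 s)); apply/reachableZ/IHn/(leq_trans lt_sr).
- by move=> u v; apply: reachableD.
by apply/reachableZ/IHn/(leq_trans lt_qr).
Qed.

(** Either the idempotent of the seed of k kills l, or it has rank one on both
    blocks and the weights distinguish them. *)
Lemma separating_element k l :
  (exists r0 j, (forall r, @cl l r = @cl k 0 -> r = r0) /\
     (@cl l r0 = @cl k 0 -> return_weight (0 : 'I_(m k).+1) j != return_weight r0 j)) ->
  exists t y c, [/\ realizes t y, y k = c *: delta_mx 0 0, c != 0 & y l = 0].
Proof.
move=> [r0 [j [uniq_r0 weight]]]; set i := @cl k 0 in weight uniq_r0 *.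
have [l0|l0] := eqVneq (@cl l r0) i; last first.
  exists (E i), ((@class_proj)^~ i), 1; split=> //; rewrite ?oner_eq0 //.
    by rewrite scale1r class_proj_seed.
  apply/matrixP => r s; rewrite !mxE; case: eqP => [eq_i|_]; rewrite ?mul0rn //.
  by rewrite -(uniq_r0 _ eq_i) eq_i eqxx in l0.
have proj_l : class_proj l i = delta_mx r0 r0.
  apply/matrixP => r s; rewrite !mxE.
  case: (eqVneq r s) => [<-|neq]; last first.
    by rewrite mulr0n; case: (r =P r0) neq => //= ->; case: (s =P r0) => // ->;
      rewrite eqxx.
  by rewrite mulr1n andbb; congr (_%:R); congr nat_of_bool; apply/eqP/eqP => [/uniq_r0|->].
have weightE h (r : 'I_(m h).+1) : (M h *m class_proj h j *m M h) r r = return_weight r j.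
  rewrite !mxE /return_weight [RHS]big_mkcond; apply: eq_bigr => q _.
  by rewrite mul_mx_diag !mxE; case: ifP; rewrite ?mulr1 ?mulr0 ?mul0r.
exists (E i *m (A *m E j *m A) *m E i + (- return_weight r0 j) *: E i).
eexists; exists (return_weight (0 : 'I_(m k).+1) j - return_weight r0 j); split.
- apply: realizesD; last exact: realizesZ (realE i).
  exact: realizesM (realizesM (realE i) (realizesM (realizesM realA (realE j)) realA))
    (realE i).
- by rewrite /= class_proj_seed rank1_sandwich weightE -scalerDl.
- by rewrite subr_eq0; apply: weight.
by rewrite /= proj_l rank1_sandwich weightE -scalerDl subrr scale0r.
Qed.

(** The blocks are filled in the order of s.  When k is treated, the product of
    the elements separating k from the blocks after it is nonzero of rank one on
    k and kills those blocks; the blocks before k are corrected afterwards. *)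
Theorem blocks_onto (s : seq K) : (forall k, k \in s) ->
  (forall s1 k s2, s = s1 ++ k :: s2 -> {in s2, forall l,
     exists r0 j, (forall r, @cl l r = @cl k 0 -> r = r0) /\
     (@cl l r0 = @cl k 0 -> return_weight (0 : 'I_(m k).+1) j != return_weight r0 j)}) ->
  forall y, exists x, realizes x y.
Proof.
move=> all_s sep; apply: realizes_triangular (all_s) _ => s1 k s2 z def_s.
have [t [y [c [rt yk c0 y0]]]] : exists t y c,
    [/\ realizes t y, y k = c *: delta_mx 0 0, c != 0 & {in s2, forall l, y l = 0}].
  elim: s2 {def_s}(sep _ _ _ def_s) => [_|l s2 IHs sep2].
    exists (E (@cl k 0)), ((@class_proj)^~ (@cl k 0)), 1; split=> //; rewrite ?oner_eq0 //.
    by rewrite scale1r class_proj_seed.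
  have [|t1 [y1 [c1 [r1 y1k c10 y10]]]] := IHs; first by move=> h hs; apply: sep2;
    rewrite inE hs orbT.
  have [t2 [y2 [c2 [r2 y2k c20 y20]]]] := separating_element (sep2 l (mem_head _ _)).
  exists (t1 *m t2), (fun h => y1 h *m y2 h), (c1 * c2); split.
  - exact: realizesM.
  - by rewrite y1k y2k -scalemxAr -scalemxAl scalerA mul_delta_mx mulrC.
  - exact: mulf_neq0.
  by move=> h; rewrite inE => /orP[/eqP->|/y10->]; rewrite ?y20 ?mulmx0 ?mul0mx.
have [b /fin_all_exists[yb /fin_all_exists[yb' rb]]] := fin_all_exists (@reachable_delta k).
have [g colG] := gram_seed k.
have [x [yx [rx yxk yx0]]] := @realizes_block _ _ _ _ _ _ k t y c b yb yb' g z rt yk c0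
  (fun r => let: And3 h _ _ := rb r in h) (fun r => let: And3 _ h _ := rb r in h)
  (fun r => let: And3 _ _ h := rb r in h) (gram_unit k) colG.
by exists x, yx; split=> // l /y0/yx0.
Qed.

End GradedModules.

(** * From surjectivity to an isomorphism *)

(** If v kills P P^T then the real matrix P maps v to a vector of norm 0. *)
Lemma gram_unitmx (F : numClosedFieldType) m n (P : 'M[F]_(m, n)) :
  (forall i j, P i j \is Num.real) -> row_free P -> P *m P^T \in unitmx.
Proof.
move=> realP freeP; rewrite -row_free_unit; apply: inj_row_free => v vG.
suff : v *m P = 0 by move/(congr1 (mulmx^~ (pinvmx P))); rewrite mulmxKp // mul0mx.
have conjP : map_mx Num.conj P^T = P^T.
  by apply/matrixP => i j; rewrite !mxE; apply/CrealP/realP.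
have : (v *m P) *m (map_mx Num.conj (v *m P))^T = 0.
  rewrite map_mxM trmx_mul map_trmx conjP mulmxA -(mulmxA v) vG.
  by rewrite mul0mx.
move/matrixP/(_ 0 0); rewrite !mxE => sum0; apply/rowP => j; rewrite [RHS]mxE.
have /psumr_eq0P : forall k, true -> 0 <= (v *m P) 0 k * ((map_mx Num.conj (v *m P))^T) k 0.
  by move=> k _; rewrite !mxE mul_conjC_ge0.
move/(_ sum0 j isT)/eqP.
have -> : (map_mx Num.conj (v *m P))^T j 0 = Num.conj ((v *m P) 0 j) by rewrite mxE mxE.
by rewrite mul_conjC_eq0 => /eqP.
Qed.

Lemma row_free_pivots (F : fieldType) m n (P : 'M[F]_(m, n)) (p : 'I_m -> 'I_n) :
  (forall r, P r (p r) != 0) -> (forall r q : 'I_m, (r < q)%N -> P q (p r) = 0) ->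
  row_free P.
Proof.
move=> piv tri; apply: inj_row_free => v vP; apply/rowP => r; rewrite mxE.
have [k] := ubnP (r : nat); elim: k => // k IHk in r *; rewrite ltnS => le_rk.
have := congr1 (fun M : 'M_(_, _) => M 0 (p r)) vP;
  rewrite !mxE (bigD1 r) //= big1 => [|q qr].
  by rewrite addr0 => /eqP; rewrite mulf_eq0 (negPf (piv r)) orbF => /eqP.
have [lt_rq|] := ltnP r q; first by rewrite tri ?mulr0.
rewrite leq_eqVlt val_eqE (negPf qr) => lt_qr.
by rewrite IHk ?mul0r // (leq_trans lt_qr).
Qed.

Section AlgIsom.

Variable F : fieldType.

Lemma alg_isom_bij (A B : algType F) (f : A -> B) : linear f -> f 1 = 1 ->
  {morph f : x y / x * y} -> (forall u, f u = 0 -> u = 0) ->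
  (forall b, exists u, f u = b) -> alg_isom A B.
Proof.
move=> linf f1 fM finj fsurj.
pose g : {lrmorphism A -> B} := HB.pack f (GRing.isLinear.Build F A B *:%R f linf)
  (GRing.isMonoidMorphism.Build A B f (conj f1 fM)).
have g_inj : injective g.
  by move=> x y /eqP; rewrite -subr_eq0 -raddfB => /eqP/finj/eqP; rewrite subr_eq0 => /eqP.
have surjb b : exists u, g u == b by have [u <-] := fsurj b; exists u; apply/eqP.
exists g; exists (fun b => xchoose (surjb b)) => [x|b].
  by apply: g_inj; apply/eqP/(xchooseP (surjb (g x))).
exact/eqP/(xchooseP (surjb b)).
Qed.

Variables (N : nat) (T : {aspace 'M[F]_N.+1}).
Variables (K : finType) (m : K -> nat) (P : forall k, 'M[F]_((m k).+1, N.+1)).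
Hypothesis T1 : 1%:M \in T.
Hypothesis P_free : forall k, row_free (P k).
Hypothesis onto : forall y, exists x, realizes T P x y.
Hypothesis dimT : (\dim T <= \sum_k (m k).+1 ^ 2)%N.

Let Z := {k : K & ('I_(m k).+1 * 'I_(m k).+1)%type}.

Let card_Z : #|{: Z}| = (\sum_k (m k).+1 ^ 2)%N.
Proof.
rewrite card_tagged sumnE big_map big_enum /=.
by apply: eq_bigr => k _; rewrite card_prod card_ord mulnn.
Qed.

Let unit_blocks (z : Z) : forall k, 'M[F]_((m k).+1) :=
  fun k => \matrix_(r, s) (z == Tagged _ (r, s) :> Z)%:R.

(** Elements of T lying over the matrix units of all blocks are independent; if
    dim T does not exceed their number they form a basis.  So all of T preserves
    the row spaces, and acts faithfully on them. *)
Lemma matrix_units_basis : \dim T = (\sum_k (m k).+1 ^ 2)%N /\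
  forall x, x \in T -> exists y, realizes T P x y /\ ((forall k, y k = 0) -> x = 0).
Proof.
have [e eP] := fin_all_exists (fun z => onto (unit_blocks z)).
pose X := [tuple e (enum_val i) | i < #|{: Z}|].
have realX (c : 'I_#|{: Z}| -> F) :
    realizes T P (\sum_i c i *: X`_i) (fun k => \sum_i c i *: unit_blocks (enum_val i) k).
  apply: (@realizes_sum _ _ _ _ _ _ _ _ (fun i k => c i *: unit_blocks (enum_val i) k)) =>
    i.
  by apply: realizesZ; rewrite -tnth_nth tnth_mktuple; apply: eP.
have c0 (c : 'I_#|{: Z}| -> F) :
    (forall k, \sum_i c i *: unit_blocks (enum_val i) k = 0) -> forall i, c i = 0.
  move=> y0 i; case def_z: (enum_val i) => [k [r s]].
  have /matrixP/(_ r s) := y0 k; rewrite summxE mxE (bigD1 i) //= big1 => [|j ji].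
    by rewrite !mxE def_z eqxx mulr1 addr0.
  rewrite !mxE; case: eqP => [e_j|]; last by rewrite mulr0.
  by case/eqP: ji; apply: enum_val_inj; rewrite e_j.
have freeX : free X.
  apply/freeP => c sum0; apply: c0 => k; have [_ /(_ k)] := realX c.
  by rewrite sum0 mulmx0 => /esym/(congr1 (mulmx^~ (pinvmx (P k))));
    rewrite mulmxKp // mul0mx.
have subX : (<<X>> <= T)%VS.
  apply/span_subvP => x /tnthP[i ->]; rewrite tnth_mktuple.
  by case: (eP (enum_val i)).
have dimX : \dim <<X>> = (\sum_k (m k).+1 ^ 2)%N by rewrite (eqnP freeX) size_tuple card_Z.
have defT : <<X>>%VS = T by apply/eqP; rewrite eqEdim subX dimX.
split=> [|x]; first by rewrite -defT.
rewrite -[x \in T]/(x \in asval T) -defT => /coord_span ->; eexists; split;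
  first exact: realX.
by move=> y0; apply: big1 => i _; rewrite (c0 _ y0) scale0r.
Qed.

Definition block_map k (u : subvs_of T) : 'M[F]_((m k).+1) :=
  P k *m vsval u *m pinvmx (P k).

Lemma block_map_realizes u y k : realizes T P (vsval u) y -> block_map k u = y k.
Proof. by case=> _ /(_ k) e; rewrite /block_map e mulmxKp. Qed.

Lemma block_map_linear k : linear (block_map k).
Proof.
by move=> a u v; rewrite /block_map !linearP /= mulmxDl -scalemxAl.
Qed.

Lemma block_map1 k : block_map k 1 = 1.
Proof.
have algid1 : algid T = 1 by apply/eqP; rewrite algid_eq1.
by rewrite /block_map /= algid1 mulmx1 mulmxVp.
Qed.

Lemma block_mapM k : {morph block_map k : u v / u * v}.
Proof.
move=> u v.
have [yu [ru _]] := matrix_units_basis.2 _ (subvsP u).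
have [yv [rv _]] := matrix_units_basis.2 _ (subvsP v).
rewrite (block_map_realizes _ ru) (block_map_realizes _ rv).
by rewrite (block_map_realizes (y := fun k => yu k *m yv k)) //; apply: realizesM.
Qed.

Lemma block_map_inj u : (forall k, block_map k u = 0) -> u = 0.
Proof.
have [y [r y0]] := matrix_units_basis.2 _ (subvsP u) => u0; apply: val_inj.
by apply: y0 => k; rewrite -(block_map_realizes _ r).
Qed.

Lemma block_map_onto y : exists u, forall k, block_map k u = y k.
Proof.
have [x [Tx rx]] := onto y; exists (Subvs Tx) => k.
by apply: block_map_realizes; split.
Qed.

Lemma block_map_single k b :
  exists u, block_map k u = b /\ forall l, l != k -> block_map l u = 0.
Proof.
have [u uE] := block_map_onto (dfwith (fun l => 0 : 'M[F]_((m l).+1)) b).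
exists u; rewrite uE dfwith_in; split=> // l lk.
by rewrite uE dfwith_out // eq_sym.
Qed.

(** Up to isomorphism, f is the projection of T onto the product of the blocks in
    s: it has the right kernel, and its values can be attained by elements that
    vanish in the other blocks. *)
Definition block_product (s : seq K) (B : algType F) (f : subvs_of T -> B) :=
  [/\ linear f, f 1 = 1, {morph f : u v / u * v},
      forall u, f u = 0 <-> {in s, forall k, block_map k u = 0} &
      forall b, exists u, f u = b /\ forall k, k \notin s -> block_map k u = 0].

Lemma block_product1 k : block_product [:: k] (block_map k).
Proof.
split; [exact: block_map_linear | exact: block_map1 | exact: block_mapM | |].
  move=> u; split=> [u0 l|u0]; first by rewrite inE => /eqP->.
  by apply: u0; rewrite inE.
move=> b; have [u [<- u0]] := block_map_single b; exists u; split=> // l.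
by rewrite inE => /u0.
Qed.

Lemma block_product_pair s1 s2 (B1 B2 : algType F) f1 f2 :
  @block_product s1 B1 f1 -> @block_product s2 B2 f2 -> ~~ has [in s1] s2 ->
  block_product (s1 ++ s2) (fun u => (f1 u, f2 u)).
Proof.
move=> [lin1 one1 mul1 ker1 onto1] [lin2 one2 mul2 ker2 onto2] dis; split.
- by move=> a u v; rewrite lin1 lin2.
- by rewrite one1 one2.
- by move=> u v; rewrite mul1 mul2.
- move=> u; split=> [[/ker1 u1 /ker2 u2] k|u0].
    by rewrite mem_cat => /orP[/u1|/u2].
  congr (_, _); [apply/ker1 | apply/ker2] => k ks; apply: u0; rewrite mem_cat ks ?orbT //.
case=> b1 b2; have [u1 [<- u10]] := onto1 b1; have [u2 [<- u20]] := onto2 b2.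
have addf (B : algType F) (f : subvs_of T -> B) : linear f ->
  forall u v, f (u + v) = f u + f v.
  by move=> linf u v; have := linf 1 u v; rewrite !scale1r.
exists (u1 + u2); split=> [|k].
  rewrite !addf //; have -> : f1 u2 = 0.
    by apply/ker1 => k ks; apply: u20; apply: contra dis => ks2; apply/hasP; exists k.
  have -> : f2 u1 = 0; last by rewrite addr0 add0r.
  by apply/ker2 => k ks; apply: u10; apply: contra dis => ks1; apply/hasP; exists k.
rewrite mem_cat negb_or => /andP[k1 k2].
by rewrite (addf _ (block_map k)) ?u10 ?u20 ?addr0 //; apply: block_map_linear.
Qed.

(** A block of size 1 is the ground field. *)
Lemma block_product_scalar k : m k = 0%N ->
  @block_product [:: k] F^o (fun u => block_map k u 0 0).
Proof.
move=> m0; have ord1k (i : 'I_(m k).+1) : i = 0.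
  by apply: val_inj; move: (ltn_ord i); rewrite {2}m0 ltnS leqn0 => /eqP.
have scal (X : 'M[F]_((m k).+1)) : X = (X 0 0)%:M.
  by apply/matrixP => i j; rewrite (ord1k i) (ord1k j) mxE eqxx mulr1n.
have [lin one mul ker onto_k] := block_product1 k; split.
- by move=> a u v; rewrite lin mxE mxE.
- by rewrite one mxE eqxx.
- by move=> u v; rewrite mul mxE (bigD1 0) //= big1 ?addr0 // => i; rewrite (ord1k i).
- move=> u; rewrite -ker; split=> [u0|->]; last by rewrite mxE.
  by rewrite [LHS]scal u0 raddf0.
move=> b; have [u [ub u0]] := onto_k (b%:M); exists u; split=> //.
by rewrite ub mxE eqxx.
Qed.

Lemma alg_isom_block_product s (B : algType F) f : (forall k, k \in s) ->
  @block_product s B f -> alg_isom (subvs_of T) B.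
Proof.
move=> all_s [lin one mul ker onto_f]; apply: (alg_isom_bij lin one mul) => [u /ker u0|b].
  by apply: block_map_inj => k; apply: u0.
by have [u []] := onto_f b; exists u.
Qed.

End AlgIsom.

(** * The Terwilliger algebra of a class scheme with real classes *)

Lemma span_ind (F : fieldType) (V : vectType F) (X : seq V) (Q : V -> Prop) :
  Q 0 -> (forall u v, Q u -> Q v -> Q (u + v)) -> (forall a u, Q u -> Q (a *: u)) ->
  {in X, forall u, Q u} -> forall u, u \in <<X>>%VS -> Q u.
Proof.
move=> Q0 QD QZ QX u; rewrite -[X]in_tupleE => /coord_span ->.
elim/big_ind: _ => // i _; apply: QZ; apply: QX.
by rewrite -[X in _ \in X]in_tupleE mem_nth.
Qed.

Lemma agenv_ind (F : fieldType) (A : falgType F) (X : seq A) (Q : A -> Prop) :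
  Q 1 -> (forall u v, Q u -> Q v -> Q (u + v)) -> (forall a u, Q u -> Q (a *: u)) ->
  (forall u v, Q u -> Q v -> Q (u * v)) -> {in X, forall u, Q u} ->
  forall u, u \in agenv <<X>> -> Q u.
Proof.
move=> Q1 QD QZ QM QX.
have Q0 : Q 0 by rewrite -(scale0r 1); apply: QZ.
have QU := span_ind Q0 QD QZ QX.
move=> u /memv_sumP[w Qw ->]; elim/big_ind: _ => // i _.
move: (w i) (Qw i isT); elim: (i : nat) => [|n IHn] v.
  by rewrite expv0 => /vlineP[a ->]; apply: QZ.
rewrite expvSl /prodv unlock; apply: (span_ind Q0 QD QZ) => _ /allpairsP[[a b] /= [aU bU
  ->]].
by apply: QM; [apply/QU/vbasis_mem | apply/IHn/vbasis_mem].
Qed.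

Section ClassScheme.

Variables (F : fieldType) (gT : finGroupType) (I : finType) (cl : gT -> I).
Hypothesis cl_conj : forall x y, (cl x == cl y) = (x \in (y ^: [set: gT])%g).
Hypothesis cl_onto : forall i, exists x, cl x = i.
Hypothesis cl_inv : forall x, cl x^-1%g = cl x.

Local Notation N := #|gT|.-1.
Local Notation T := (terwilliger F gT).

Definition cls_set i : {set gT} := [set x | cl x == i].

Lemma clJ x g : cl (x ^ g)%g = cl x.
Proof. by apply/eqP; rewrite cl_conj memJ_class ?inE. Qed.

Lemma cl_mulC x y : cl (x * y)%g = cl (y * x)%g.
Proof. by rewrite -(clJ (x * y)%g x) conjgE mulgA mulKg. Qed.

Lemma cls_setE x : cls_set (cl x) = (x ^: [set: gT])%g.
Proof. by apply/setP => y; rewrite inE cl_conj. Qed.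

Lemma cls_set_classes i : cls_set i \in classes [set: gT].
Proof. by have [x <-] := cl_onto i; rewrite cls_setE mem_classes ?inE. Qed.

Definition adj i : 'M[F]_N.+1 := class_adj F (cls_set i).
Definition dual i : 'M[F]_N.+1 := class_dual F (cls_set i).

Lemma adjE i a b : adj i a b = (cl ((elt_of a)^-1 * elt_of b)%g == i)%:R.
Proof. by rewrite mxE /class_rel inE. Qed.

Lemma dualE i a b : dual i a b = (cl (elt_of b) == i)%:R *+ (a == b).
Proof. by rewrite !mxE /class_rel inE idx_ofK invg1 mul1g; case: (a =P b) => [->|]. Qed.

Lemma terwilliger_ind (Q : 'M[F]_N.+1 -> Prop) :
  Q 1 -> (forall u v, Q u -> Q v -> Q (u + v)) -> (forall a u, Q u -> Q (a *: u)) ->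
  (forall u v, Q u -> Q v -> Q (u *m v)) ->
  (forall i, Q (adj i)) -> (forall i, Q (dual i)) -> forall x, x \in T -> Q x.
Proof.
move=> Q1 QD QZ QM Qa Qd x; apply: (agenv_ind Q1 QD QZ QM) => y.
by rewrite mem_cat => /orP[] /imageP[_ /imsetP[z _ ->] ->]; rewrite -cls_setE;
  [apply: Qa | apply: Qd].
Qed.

Let mem_gens x : x \in terwilliger_gens F gT -> x \in T.
Proof. by move=> Gx; apply: (subvP (sub_agenv _)); apply: memv_span. Qed.

Lemma adj_mem i : adj i \in T.
Proof.
apply: mem_gens; rewrite mem_cat; apply/orP; left.
exact: (image_f (@class_adj F gT) (cls_set_classes i)).
Qed.

Lemma dual_mem i : dual i \in T.
Proof.
apply: mem_gens; rewrite mem_cat; apply/orP; right.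
exact: (image_f (@class_dual F gT) (cls_set_classes i)).
Qed.

Lemma terwilliger1 : 1%:M \in T.
Proof.
rewrite -[_ \in T]/((1 : 'M[F]_N.+1) \in agenv _) memvE.
exact: sub1_agenv.
Qed.

Lemma adj_sym i : (adj i)^T = adj i.
Proof.
by apply/matrixP => a b; rewrite mxE !adjE -cl_inv invMg invgK.
Qed.

Lemma dual_sym i : (dual i)^T = dual i.
Proof.
apply/matrixP => a b; rewrite mxE !dualE; have [->//|ab] := eqVneq a b.
by rewrite !mulr0n.
Qed.

(** Rows indexed by group elements, so that sums over matrix indices become sums
    over the group. *)
Definition fun_mx n (f : 'I_n -> gT -> F) : 'M[F]_(n, N.+1) :=
  \matrix_(r, a) f r (elt_of a).

Lemma sum_elt (V : nmodType) (f : gT -> V) : \sum_a f (elt_of a) = \sum_x f x.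
Proof.
rewrite [RHS](reindex (@elt_of gT)) //; exists (@idx_of gT) => x _.
  exact: elt_ofK.
exact: idx_ofK.
Qed.

Lemma fun_mx_adj n (f : 'I_n -> gT -> F) i :
  fun_mx f *m adj i = fun_mx (fun r y => \sum_(t | cl t == i) f r (y * t)%g).
Proof.
apply/matrixP => r a; rewrite !mxE.
transitivity (\sum_x f r x * (cl (x^-1 * elt_of a)%g == i)%:R).
  by rewrite -sum_elt; apply: eq_bigr => b _; rewrite adjE mxE.
rewrite (reindex (fun t => elt_of a * t)%g) /=; last first.
  by exists (fun t => (elt_of a)^-1 * t)%g => x _; rewrite ?mulKg ?mulKVg.
rewrite [RHS]big_mkcond; apply: eq_bigr => t _.
rewrite invMg -mulgA mulVg mulg1 cl_inv.
by case: eqP; rewrite ?mulr1 ?mulr0.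
Qed.

Lemma fun_mx_dual n (f : 'I_n -> gT -> F) i :
  fun_mx f *m dual i = fun_mx (fun r y => f r y * (cl y == i)%:R).
Proof.
apply/matrixP => r a; rewrite !mxE (bigD1 a) //= big1 => [|b ba].
  by rewrite dualE !mxE eqxx mulr1n addr0.
by rewrite dualE (negPf ba) mulr0n mulr0.
Qed.

(** The structure constants of the class algebra, c j l being the number of ways
    to move an element of class l into class j by an element of class i. *)
Lemma adjM i j (c : I -> I -> nat) :
  (forall z, #|[set t | (cl t == i) && (cl (t * z)%g == j)]| = c j (cl z)) ->
  adj i *m adj j = \sum_l (c j l)%:R *: adj l.
Proof.
move=> cE; apply/matrixP => a b; rewrite !mxE summxE.
transitivity (\sum_x ((cl ((elt_of a)^-1 * x)%g == i) &&
  (cl (x^-1 * elt_of b)%g == j))%:R : F).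
  by rewrite -sum_elt; apply: eq_bigr => d _; rewrite !adjE -natrM mulnb.
apply: esym; rewrite (bigD1 (cl ((elt_of a)^-1 * elt_of b)%g)) //= big1 => [|l /negPf nl];
  last first.
  by rewrite mxE adjE eq_sym nl mulr0.
rewrite addr0 mxE adjE eqxx mulr1 -cE -sum1_card natr_sum big_mkcond.
rewrite [RHS](reindex (fun t => elt_of a * t^-1)%g) /=; last first.
  by exists (fun t => t^-1 * elt_of a)%g => x _; rewrite !(invMg, invgK) ?mulgKV ?mulKVg
    // mulgA.
apply: eq_bigr => t _; rewrite inE mulKg cl_inv invMg invgK -mulgA.
by case: andP.
Qed.

End ClassScheme.

(** * Invariants under conjugation and inversion *)

Section Twist.

Variable gT : finGroupType.
Local Notation H := (gT * 'I_2)%type.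

Definition twist (x : gT) (h : H) : gT :=
  if h.2 == 0 then (x ^ h.1)%g else (x ^ h.1)^-1%g.

Lemma twist1 x : twist x 1%g = x.
Proof. by rewrite /twist /= conjg1. Qed.

Lemma twistM x : act_morph twist x.
Proof.
case=> a ia [b ib]; rewrite /twist /= conjgM.
case: ia => [[|[|//]] ?]; case: ib => [[|[|//]] ?];
  by rewrite -!val_eqE /= ?conjVg ?invgK.
Qed.

Definition twist2 (p : gT * gT) (h : H) := (twist p.1 h, twist p.2 h).

Lemma twist21 : twist2^~ 1%g =1 id.
Proof. by case=> x y; rewrite /twist2 !twist1. Qed.

Lemma twist2M p : act_morph twist2 p.
Proof. by move=> a b; rewrite /twist2 !twistM. Qed.

Definition twist_action := TotalAction twist21 twist2M.

Definition pair_orbits : {set {set gT * gT}} :=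
  orbit twist_action [set: H] @: [set: gT * gT].

Definition num_commuting (g : gT) := #|[set x | (x * g)%g == (g * x)%g]|.
(** The number of x such that conjugation by g inverts x. *)
Definition num_inverting (g : gT) := #|[set x | (x * g * x)%g == g]|.

(** Count fixed points: those of (g, 0) on G are the elements commuting with g,
    those of (g, 1) the elements inverted by g, and both are squared on G x G. *)
Lemma card_pair_orbits :
  (#|pair_orbits| * (#|gT| * 2) = \sum_g (num_commuting g ^ 2 + num_inverting g ^ 2))%N.
Proof.
have acts : [acts [set: H], on [set: gT * gT] | twist_action].
  by apply/actsP => h _ p; rewrite !inE.
have := Frobenius_Cauchy acts; rewrite cardsT card_prod card_ord => <-.
have fixE h : #|'Fix_(setT | twist_action)[h]%g| = (#|[set x | twist x h == x]| ^ 2)%N.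
  rewrite -mulnn -cardsX; apply: eq_card => -[x y]; rewrite in_setI in_setT in_setX.
  by apply/afix1P/andP => [[/= xh yh]|[]]; rewrite !inE;
    [rewrite xh yh | move=> /eqP xh /eqP yh; rewrite /= /twist2 xh yh].
under eq_bigr do rewrite fixE.
rewrite (eq_bigl xpredT) => [|h]; last by rewrite inE.
rewrite -(pair_bigA _ (fun g i => #|[set x | twist x (g, i) == x]| ^ 2)%N) /=.
apply: eq_bigr => g _; rewrite big_ord_recl big_ord1.
congr (_ ^ 2 + _ ^ 2)%N; apply: eq_card => x; rewrite !inE /twist /= conjgE.
  by rewrite -(inj_eq (mulgI g)) !mulgA mulgV mul1g.
by rewrite -(inj_eq (mulgI (x * g)%g)) !invMg invgK !mulgA mulgK mulgV mul1g eq_sym.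
Qed.

End Twist.

Section Invariants.

Variables (F : fieldType) (gT : finGroupType) (I : finType) (cl : gT -> I).
Hypothesis cl_conj : forall x y, (cl x == cl y) = (x \in (y ^: [set: gT])%g).
Hypothesis cl_inv : forall x, cl x^-1%g = cl x.

Local Notation N := #|gT|.-1.
Local Notation T := (terwilliger F gT).
Local Notation H := (gT * 'I_2)%type.
Local Notation adj := (adj F cl).
Local Notation dual := (dual F cl).

Definition entry_at (X : 'M[F]_N.+1) (x y : gT) := X (idx_of x) (idx_of y).

Definition invariant (X : 'M[F]_N.+1) :=
  forall x y (h : H), entry_at X (twist x h) (twist y h) = entry_at X x y.

Lemma twist_inj (h : H) : injective (fun x : gT => twist x h).
Proof.
apply: (can_inj (g := fun x => twist x (h^-1)%g)) => x.
by rewrite /= -twistM mulgV twist1.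
Qed.

Lemma cl_twist x y (h : H) : cl ((twist x h)^-1 * twist y h)%g = cl (x^-1 * y)%g.
Proof.
rewrite /twist; case: ifP => _; first by rewrite -conjVg -conjMg (clJ cl_conj).
rewrite invgK -[in LHS]cl_inv invMg invgK (cl_mulC cl_conj) -[RHS](clJ cl_conj _ h.1).
by rewrite conjMg conjVg.
Qed.

Lemma cl_twist1 x (h : H) : cl (twist x h) = cl x.
Proof. by rewrite /twist; case: ifP => _; rewrite ?cl_inv (clJ cl_conj). Qed.

(** Conjugation preserves the classes of quotients.  Inversion replaces
    x^-1 y by x y^-1, which is conjugate to the inverse of x^-1 y. *)
Lemma terwilliger_invariant X : X \in T -> invariant X.
Proof.
move: X; apply: (terwilliger_ind cl_conj).
- by move=> x y h; rewrite /entry_at !mxE !(inj_eq (can_inj (@idx_ofK _))) (inj_eq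
    (@twist_inj h)).
- by move=> u v iu iv x y h; have := iu x y h; have := iv x y h;
    rewrite /entry_at !mxE => -> ->.
- by move=> a u iu x y h; have := iu x y h; rewrite /entry_at !mxE => ->.
- move=> u v iu iv x y h; rewrite /entry_at !mxE.
  pose s z := entry_at u (twist x h) z * entry_at v z (twist y h).
  transitivity (\sum_z s z).
    by rewrite -[RHS]sum_elt; apply: eq_bigr => k _; rewrite /s /entry_at elt_ofK.
  rewrite (reindex_inj (@twist_inj h)) /= -[LHS]sum_elt.
  by apply: eq_bigr => k _; rewrite /s iu iv /entry_at elt_ofK.
- by move=> i x y h; rewrite /entry_at !adjE !idx_ofK cl_twist.
move=> i x y h; rewrite /entry_at !dualE !idx_ofK.
rewrite !(inj_eq (can_inj (@idx_ofK _))) (inj_eq (@twist_inj h)).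
by rewrite cl_twist1.
Qed.

Definition orbit_mx (o : {set gT * gT}) : 'M[F]_N.+1 :=
  \matrix_(i, j) ((elt_of i, elt_of j) \in o)%:R.

Definition invariants : {vspace 'M[F]_N.+1} :=
  <<[seq orbit_mx o | o in pair_orbits gT]>>%VS.

Lemma dim_invariants : (\dim invariants <= #|pair_orbits gT|)%N.
Proof. by apply: leq_trans (dim_span _) _; rewrite size_image. Qed.

Lemma invariant_mem X : invariant X -> X \in invariants.
Proof.
move=> iX.
have -> : X = \sum_(o in pair_orbits gT) entry_at X (repr o).1 (repr o).2 *: orbit_mx o.
  apply/matrixP => i j; rewrite summxE.
  pose p := (elt_of i, elt_of j); pose o := orbit (twist_action gT) setT p.
  rewrite (bigD1 o) ?imset_f ?inE //= big1 => [|o' /andP[/imsetP[q _ ->] neq]].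
    rewrite !mxE orbit_refl mulr1 addr0.
    have /orbitP[h _ <-] := mem_repr _ (orbit_refl (twist_action gT) setT p).
    by rewrite /= iX /entry_at !elt_ofK.
  rewrite !mxE -/p; have [/orbit_eqP e|_] := boolP (p \in _); last by rewrite mulr0.
  by rewrite /o e eqxx in neq.
by apply: memv_suml => o oP; apply/memvZ/memv_span/image_f.
Qed.

Definition pair_sum (x y : gT) : 'M[F]_N.+1 :=
  \matrix_(i, j) \sum_(h : H) ((elt_of i == twist x h) && (elt_of j == twist y h))%:R.

Lemma pair_sum_mem x y : pair_sum x y \in invariants.
Proof.
apply: invariant_mem => u v h; rewrite /entry_at !mxE !idx_ofK.
rewrite (reindex_inj (mulIg h)) /=; apply: eq_bigr => k _.
by rewrite !twistM !(inj_eq (@twist_inj h)).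
Qed.

End Invariants.

(** * Two modules that become isomorphic over the Terwilliger algebra *)

Section CentralCharacter.

Variables (F : fieldType) (gT : finGroupType) (I : finType) (cl : gT -> I).
Local Notation N := #|gT|.-1.
Local Notation adj := (adj F cl).

(** The matrices P A_l form a vector killed by c^2 - a, because multiplication by
    A_1^2 can be carried out before or after multiplication by A_l.  A linear
    combination b of the rows of c^2 - a that involves only the columns k, i0 and
    i1 expresses P A_k by P A_0 = P and P A_1. *)
Lemma adj_central n (P : 'M[F]_(n, N.+1)) (i0 i1 : I) (c : I -> I -> F) (a : F)
    (b : I -> F) d mu nu k :
  (forall j, adj i1 *m adj j = \sum_l c j l *: adj l) -> adj i0 = 1%:M ->
  P *m adj i1 *m adj i1 = a *: P ->
  d != 0 ->
  (forall l, \sum_j b j * (\sum_k c j k * c k l - a *+ (j == l)) =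
     d *+ (k == l) - mu *+ (i0 == l) - nu *+ (i1 == l)) ->
  P *m adj k = (mu / d) *: P + (nu / d) *: (P *m adj i1).
Proof.
move=> adjM adj0 P11 d0 cert.
have sq j : \sum_l (\sum_k c j k * c k l - a *+ (j == l)) *: (P *m adj l) = 0.
  under eq_bigr do rewrite scalerBl; rewrite sumrB.
  have -> : \sum_l a *+ (j == l) *: (P *m adj l) = P *m adj i1 *m adj i1 *m adj j.
    rewrite P11 (bigD1 j) //= eqxx big1 => [|l /negPf lj].
      by rewrite addr0 mulr1n -scalemxAl.
    by rewrite eq_sym lj mulr0n scale0r.
  rewrite -!mulmxA [adj i1 *m adj j]adjM !mulmx_sumr.
  rewrite [X in _ - X](_ : _ = \sum_k \sum_l (c j k * c k l) *: (P *m adj l)).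
    rewrite exchange_big /=; apply/eqP; rewrite subr_eq0; apply/eqP.
    by apply: eq_bigr => l _; rewrite scaler_suml.
  apply: eq_bigr => q _; rewrite -!scalemxAr adjM mulmx_sumr scaler_sumr.
  by apply: eq_bigr => l _; rewrite -scalemxAr scalerA.
have /eqP : \sum_j b j *: (\sum_l (\sum_k c j k * c k l - a *+ (j == l)) *: (P *m adj l))
  = 0.
  by apply: big1 => j _; rewrite sq scaler0.
under eq_bigr do rewrite scaler_sumr; rewrite exchange_big /=.
under eq_bigr => l _.
  under eq_bigr do rewrite scalerA.
  rewrite -scaler_suml cert !scalerBl; over.
have pick1 i x : \sum_l x *+ (i == l) *: (P *m adj l) = x *: (P *m adj i).
  rewrite (bigD1 i) //= eqxx big1 => [|l /negPf li]; first by rewrite addr0.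
  by rewrite eq_sym li mulr0n scale0r.
rewrite !sumrB !pick1 adj0 mulmx1 -addrA -opprD subr_eq0 => /eqP e.
apply: (can_inj (scalerK d0)) => /=.
by rewrite e scalerDr !scalerA !mulrA ![d * _]mulrC !mulfK.
Qed.

End CentralCharacter.

Section MergedPair.

Variables (F : fieldType) (gT : finGroupType) (I : finType) (cl : gT -> I).
Hypothesis cl_conj : forall x y, (cl x == cl y) = (x \in (y ^: [set: gT])%g).
Hypothesis cl_inv : forall x, cl x^-1%g = cl x.

Local Notation N := #|gT|.-1.
Local Notation T := (terwilliger F gT).
Local Notation H := (gT * 'I_2)%type.
Local Notation adj := (adj F cl).
Local Notation dual := (dual F cl).

Variables (n : nat) (f f' : 'I_n -> gT -> F) (c : 'I_n -> I).
Hypothesis c_inj : injective c.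
Hypothesis f_supp : forall r x, cl x != c r -> f r x = 0.
Hypothesis f'_supp : forall r x, cl x != c r -> f' r x = 0.
Hypothesis same_adj : forall i, exists y,
  fun_mx f *m adj i = y *m fun_mx f /\ fun_mx f' *m adj i = y *m fun_mx f'.
Variables (p : 'I_n -> gT) (w : 'I_n -> 'I_n -> gT).
Hypothesis fp : forall r, f r (p r) != 0.
Hypothesis f'p : forall r, f' r (p r) != 0.
Hypothesis clw : forall r s, cl (w r s) = c r.
Hypothesis differ : forall r s,
  f' s (p s) * (\sum_(h : H | twist (p s) h == p s) f r (twist (w r s) h)) !=
  f s (p s) * (\sum_(h : H | twist (p s) h == p s) f' r (twist (w r s) h)).

(** Both row spaces carry the same action of T, since they do for the generators. *)
Lemma terwilliger_same X : X \in T -> exists y,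
  fun_mx f *m X = y *m fun_mx f /\ fun_mx f' *m X = y *m fun_mx f'.
Proof.
move: X; apply: (terwilliger_ind cl_conj).
- by exists 1%:M; rewrite !mulmx1 !mul1mx.
- move=> u v [y [e e']] [z [g g']]; exists (y + z).
  by rewrite !mulmxDr !mulmxDl e e' g g'.
- by move=> a u [y [e e']]; exists (a *: y); rewrite -!scalemxAr -!scalemxAl e e'.
- move=> u v [y [e e']] [z [g g']]; exists (y *m z).
  by rewrite !mulmxA e e' -!mulmxA g g'.
- exact: same_adj.
move=> i; exists (diag_mx (\row_r (c r == i)%:R)); rewrite !fun_mx_dual !mul_diag_mx.
split; apply/matrixP => r a; rewrite !mxE; have [->|ne] := eqVneq (cl (elt_of a)) (c r);
  by rewrite ?(f_supp ne) ?(f'_supp ne) ?mulr0 ?mul0r // mulrC.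
Qed.

Let g (q : 'I_n -> gT -> F) s x : F := (x == p s)%:R / q s (p s).
Let compression q : 'M[F]_N.+1 -> 'M[F]_n := mulmxr (fun_mx (g q))^T \o mulmx (fun_mx q).

Lemma fun_mx_pair_sum (q : 'I_n -> gT -> F) x y : compression q (pair_sum F x y) =
  \matrix_(a, b) \sum_h q a (twist x h) * g q b (twist y h).
Proof.
apply/matrixP => a b; rewrite !mxE.
transitivity (\sum_v (\sum_u q a u * (\sum_h ((u == twist x h) &&
  (v == twist y h))%:R)) * g q b v).
  rewrite -[RHS]sum_elt; apply: eq_bigr => j _; rewrite !mxE; congr (_ * _).
  by rewrite -[RHS]sum_elt; apply: eq_bigr => i _; rewrite !mxE.
under eq_bigr => v _.
  under eq_bigr do rewrite mulr_sumr.
  rewrite exchange_big /= mulr_suml; over.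
rewrite exchange_big /=; apply: eq_bigr => h _.
rewrite (bigD1 (twist y h)) //= eqxx [X in _ + X]big1 ?addr0 => [|v /negPf vy]; last first.
  by rewrite big1 ?mul0r // => u _; rewrite vy andbF mulr0.
congr (_ * _); rewrite (bigD1 (twist x h)) //= eqxx big1 ?addr0 ?mulr1 // => u /negPf ->.
by rewrite mulr0.
Qed.

Lemma fun_mx_rinv (q : 'I_n -> gT -> F) :
  (forall r x, cl x != c r -> q r x = 0) -> (forall r, q r (p r) != 0) ->
  fun_mx q *m (fun_mx (g q))^T = 1%:M.
Proof.
move=> q_supp qp; apply/matrixP => a b; rewrite !mxE.
transitivity (\sum_x q a x * g q b x).
  by rewrite -[RHS]sum_elt; apply: eq_bigr => j _; rewrite !mxE.
rewrite (bigD1 (p b)) //= big1 => [|x /negPf xp]; last by rewrite /g xp mul0r mulr0.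
rewrite /g eqxx div1r addr0; have [->|ab] := eqVneq a b; first by rewrite divff.
rewrite q_supp ?mul0r //; have [->|/q_supp/eqP] := eqVneq (cl (p b)) (c b).
  by rewrite (inj_eq c_inj) eq_sym.
by rewrite (negPf (qp b)).
Qed.

(** The difference of the compressions of X to the two row spaces vanishes on T.
    On the invariants it is onto: the sum over H of the matrix units at the
    conjugates of (w r s, p s) is mapped to a nonzero multiple of the matrix unit
    (r, s), as the rows have their supports in different classes. *)
Lemma dim_terwilliger_merged : (\dim T + n * n <= #|pair_orbits gT|)%N.
Proof.
have cl_p s : cl (p s) = c s.
  by apply/eqP/negPn/negP => /f_supp/eqP; rewrite (negPf (fp s)).
pose d := linfun (compression f \- compression f').
have dE X : d X = compression f X - compression f' X by rewrite lfunE.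
have subT : (T <= invariants F gT :&: lker d)%VS.
  apply/subvP => X TX; rewrite memv_cap memv_ker dE.
  rewrite invariant_mem /=; last exact: terwilliger_invariant cl_conj cl_inv _ TX.
  have [y [e e']] := terwilliger_same TX.
  by rewrite /compression /= e e' -!mulmxA !fun_mx_rinv // subrr.
have d_onto : (d @: invariants F gT)%VS = fullv.
  apply/eqP; rewrite eqEsubv subvf; apply/subvP => X _.
  rewrite (matrix_sum_delta X); apply: memv_suml => r _; apply: memv_suml => s _.
  apply: memvZ.
  pose v := (\sum_(h : H | twist (p s) h == p s) f r (twist (w r s) h)) / f s (p s)
    - (\sum_(h : H | twist (p s) h == p s) f' r (twist (w r s) h)) / f' s (p s).
  have v0 : v != 0.
    rewrite subr_eq0 (can2_eq (divfK (fp s)) (mulfK (fp s))) mulrAC.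
    rewrite eq_sym (can2_eq (divfK (f'p s)) (mulfK (f'p s))) eq_sym mulrC.
    by rewrite [X in _ != X]mulrC differ.
  have -> : delta_mx r s = v^-1 *: d (pair_sum F (w r s) (p s)).
    rewrite dE !fun_mx_pair_sum; apply/matrixP => a b; rewrite !mxE.
    have sumE (q : 'I_n -> gT -> F) : (forall r x, cl x != c r -> q r x = 0) ->
        \sum_h q a (twist (w r s) h) * g q b (twist (p s) h) =
        ((a == r) && (b == s))%:R *
        ((\sum_(h : H | twist (p s) h == p s) q r (twist (w r s) h)) / q s (p s)).
      move=> q_supp; have [->|ar] := eqVneq a r; last first.
        rewrite mul0r big1 // => h _; rewrite q_supp ?mul0r //.
        by rewrite (cl_twist1 cl_conj cl_inv) clw (inj_eq c_inj) eq_sym.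
      have [->|bs] := eqVneq b s; last first.
        rewrite mul0r big1 // => h _; rewrite /g; case: eqP => [e|];
          last by rewrite mul0r mulr0.
        have := cl_twist1 cl_conj cl_inv (p s) h; rewrite e !cl_p => /c_inj bs'.
        by rewrite bs' eqxx in bs.
      rewrite mul1r mulr_suml [RHS]big_mkcond; apply: eq_bigr => h _.
      by rewrite /g; case: eqP; rewrite ?mul0r ?mulr0 ?div1r.
    by rewrite !sumE // -mulrBr mulrC -mulrA divff // mulr1.
  by apply: memvZ; apply: memv_img; apply: pair_sum_mem.
apply: leq_trans (dim_invariants F gT); rewrite -(limg_ker_dim d (invariants F gT)) d_onto.
rewrite dimvf leq_add2r; exact: dimvS.
Qed.

End MergedPair.

(** * Permutations of seven points as words *)

Local Open Scope nat_scope.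

(** The word of the images of 0, ..., 6. *)
Notation code := (seq nat).
Definition code1 : code := iota 0 7.
(** Products act from the left to the right, as for permutations. *)
Definition codeM (u v : code) : code := [seq nth 0 v a | a <- u].
Definition codeV (u : code) : code := [seq index a u | a <- code1].
Definition codeJ (u v : code) : code := codeM (codeM (codeV v) u) v.
Fixpoint code_eq (u v : seq nat) : bool :=
  match u, v with
  | [::], [::] => true
  | a :: u', b :: v' => if eqn a b then code_eq u' v' else false
  | _, _ => false
  end.
(** Evaluated once, so that the checks below run over a literal list. *)
Definition codes : seq code := Eval vm_compute in permutations code1.

(** Functions on permutations are tabulated in tries indexed by the words. *)
Inductive trie (A : Type) : Type := Tip | Leaf of A | Node of seq (trie A).
Arguments Tip {A}.
Fixpoint tget A (t : trie A) (u : code) : option A :=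
  match u, t with
  | [::], Leaf a => Some a
  | d :: u', Node ts => tget (nth Tip ts d) u'
  | _, _ => None
  end.
Fixpoint tset A (t : trie A) (u : code) (a : A) : trie A :=
  if u is d :: u' then
    let ts := if t is Node ts then ts else [::] in
    Node (set_nth Tip ts d (tset (nth Tip ts d) u' a))
  else Leaf a.

(** The classes are numbered by their place in this list. *)
Definition cycle_types : seq (seq nat) :=
  [:: [:: 1; 1; 1; 1; 1; 1; 1]; [:: 2; 1; 1; 1; 1; 1]; [:: 2; 2; 1; 1; 1];
      [:: 3; 1; 1; 1; 1]; [:: 2; 2; 2; 1]; [:: 3; 2; 1; 1]; [:: 4; 1; 1; 1];
      [:: 3; 2; 2]; [:: 3; 3; 1]; [:: 4; 2; 1]; [:: 5; 1; 1]; [:: 4; 3];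
      [:: 5; 2]; [:: 6; 1]; [:: 7]].

Fixpoint cycle_from (fuel : nat) (u : code) (start a : nat) : seq nat :=
  if fuel is n.+1 then
    let b := nth 0 u a in
    a :: (if eqn b start then [::] else cycle_from n u start b)
  else [::].
Definition cycles (u : code) : seq (seq nat) :=
  sort (fun c d => size d <= size c)
    (foldl (fun cs a => if a \in flatten cs then cs
                        else rcons cs (cycle_from 7 u a a)) [::] code1).
Definition cycle_type (u : code) : nat := index (map size (cycles u)) cycle_types.
(** The cycles of u written one after the other form a word that conjugates the
    standard representative of the class to u. *)
Definition cycle_word (u : code) : code := flatten (cycles u).
Definition class_reps : seq code := Eval vm_compute in
  map (fun l => flatten (map (fun se => rcons (iota se.1.+1 se.2.-1) se.1)
     (zip (0 :: scanl addn 0 l) l))) cycle_types.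

(** * The modules and their bases *)

(** The data of the multiplicity space of the character of Sym(7) of shape
    young_shape, on which inversion acts by -1 if odd_inv holds.  The first row
    is the Young symmetrizer applied to the point seed_pt, divided by
    seed_content; row r lives in the class numbered by entry r of row_class; and
    trans_mx is the matrix of A. *)
Record module_data := ModuleData {
  young_shape : seq nat; odd_inv : bool; seed_pt : code; seed_content : Z;
  row_class : seq nat; trans_mx : seq (seq Z) }.

(** The last module is the one that merges with number 6. *)
Definition modules : seq module_data := [::
  ModuleData [:: 7] false [:: 0; 1; 2; 3; 4; 5; 6] 10080%BZ
    [:: 0; 1; 2; 3; 4; 5; 6; 7; 9; 8; 10; 11; 12; 13; 14]
    [:: [:: 0; 1; 0; 0; 0; 0; 0; 0; 0; 0; 0; 0; 0; 0; 0]%BZ;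
        [:: 21; 0; 2; 3; 0; 0; 0; 0; 0; 0; 0; 0; 0; 0; 0]%BZ;
        [:: 0; 10; 0; 0; 3; 3; 2; 0; 0; 0; 0; 0; 0; 0; 0]%BZ;
        [:: 0; 10; 0; 0; 0; 1; 4; 0; 0; 0; 0; 0; 0; 0; 0]%BZ;
        [:: 0; 0; 3; 0; 0; 0; 0; 3; 2; 0; 0; 0; 0; 0; 0]%BZ;
        [:: 0; 0; 12; 6; 0; 0; 0; 2; 4; 6; 5; 0; 0; 0; 0]%BZ;
        [:: 0; 0; 4; 12; 0; 0; 0; 0; 1; 0; 5; 0; 0; 0; 0]%BZ;
        [:: 0; 0; 0; 0; 6; 1; 0; 0; 0; 0; 0; 2; 5; 0; 0]%BZ;
        [:: 0; 0; 0; 0; 12; 6; 3; 0; 0; 0; 0; 3; 5; 6; 0]%BZ;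
        [:: 0; 0; 0; 0; 0; 4; 0; 0; 0; 0; 0; 4; 0; 3; 0]%BZ;
        [:: 0; 0; 0; 0; 0; 6; 12; 0; 0; 0; 0; 0; 1; 6; 0]%BZ;
        [:: 0; 0; 0; 0; 0; 0; 0; 4; 2; 6; 0; 0; 0; 0; 7]%BZ;
        [:: 0; 0; 0; 0; 0; 0; 0; 12; 4; 0; 1; 0; 0; 0; 7]%BZ;
        [:: 0; 0; 0; 0; 0; 0; 0; 0; 8; 9; 10; 0; 0; 0; 7]%BZ;
        [:: 0; 0; 0; 0; 0; 0; 0; 0; 0; 0; 0; 12; 10; 6; 0]%BZ];
  ModuleData [:: 6; 1] false [:: 0; 1; 2; 3; 4; 6; 5] 240%BZ
    [:: 1; 2; 3; 4; 5; 6; 5; 7; 9; 8; 9; 10; 11; 12; 13]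
    [:: [:: 0; 1; 2; 0; 0; 0; 0; 0; 0; 0; 0; 0; 0; 0; 0]%BZ;
        [:: 6; 0; 0; 2; 1; 2; 0; 0; 0; 0; 0; 0; 0; 0; 0]%BZ;
        [:: 8; 0; 0; 0; (-1); 3; 3; 0; 0; 0; 0; 0; 0; 0; 0]%BZ;
        [:: 0; 1; 0; 0; 0; 0; 0; 1; 2; 0; 0; 0; 0; 0; 0]%BZ;
        [:: 0; 22; 3; 0; 0; 0; 0; (-1); 6; 12; 6; 12; 0; 0; 0]%BZ;
        [:: 0; 4; 9; 0; 0; 0; 0; 0; 1; 0; (-1); 4; 0; 0; 0]%BZ;
        [:: 0; 8; 3; 0; 0; 0; 0; (-1); 3; 5; 1; 5; 0; 0; 0]%BZ;
        [:: 0; 0; 0; 4; 1; 0; (-3); 0; 0; 0; 0; 0; 2; 3; 0]%BZ;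
        [:: 0; 0; 0; 12; 0; 1; 3; 0; 0; 0; 0; 0; 1; 1; 6]%BZ;
        [:: 0; 0; 0; 0; 0; 0; 2; 0; 0; 0; 0; 0; (-1); 0; 3]%BZ;
        [:: 0; 0; 0; 4; 6; (-2); (-12); 0; 0; 0; 0; 0; (-2); 5; 2]%BZ;
        [:: 0; 0; 0; 0; 0; 8; 6; 0; 0; 0; 0; 0; 0; (-1); 5]%BZ;
        [:: 0; 0; 0; 0; 0; 0; 0; 4; 2; (-3); (-2); 0; 0; 0; 0]%BZ;
        [:: 0; 0; 0; 0; 0; 0; 0; 6; 0; 0; 4; (-1); 0; 0; 0]%BZ;
        [:: 0; 0; 0; 0; 0; 0; 0; 0; 8; 9; 0; 5; 0; 0; 0]%BZ];
  ModuleData [:: 5; 2] false [:: 0; 1; 2; 3; 4; 6; 5] 480%BZ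
    [:: 1; 3; 6; 5; 2; 2; 10; 9; 5; 4; 7; 9; 6; 5; 10; 9; 13; 8; 13; 14; 11;
      12; 14; 12; 7; 11]
    [:: [:: 0; 1; 0; 0; 1; 0; 0; 0; 0; 0; 0; 0; 0; 0; 0; 0; 0; 0; 0; 0; 0; 0; 0;
       0; 0; 0]%BZ;
        [:: 6; 0; 2; 1; 0; 0; 0; 0; 0; 0; 0; 0; 0; 0; 0; 0; 0; 0; 0; 0; 0; 0; 0;
       0; 0; 0]%BZ;
        [:: 0; 6; 0; 0; 4; (-4); 3; 1; 0; 0; 0; 0; 0; 0; 0; 0; 0; 0; 0; 0; 0; 0;
       0; 0; 0; 0]%BZ;
        [:: 0; 6; 0; 0; 2; 4; 2; 2; 0; 0; 2; 0; 0; 0; 1; 0; 0; 3; 0; 0; 0; 0; 0;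
       0; 0; 0]%BZ;
        [:: 11; 0; 1; 1; 0; 0; 0; 0; 3; 2; 0; 0; 1; 0; 0; 0; 0; 0; 0; 0; 0; 0;
       0; 0; 0; 0]%BZ;
        [:: 8; 0; (-1); 0; 0; 0; 0; 0; 0; 1; 0; 0; 1; 2; 0; 0; 0; 0; 0; 0; 0; 0;
       0; 0; 0; 0]%BZ;
        [:: 0; 0; 4; 6; 0; 0; 0; 0; 6; 0; 0; 0; 0; (-6); 0; 0; 0; 0; 0; 0; 0; 1;
       0; 0; 0; 0]%BZ;
        [:: 0; 0; 3; 0; 0; 0; 0; 0; 0; 4; 0; 0; 0; 3; 0; 0; 1; 0; 0; 0; 3; 3; 0;
       0; 0; 0]%BZ;
        [:: 0; 1; 0; 0; 6; 0; 1; 0; 0; 0; 1; 0; 0; 0; 1; 4; 0; 1; 0; 0; 0; 0; 0;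
       0; 1; 0]%BZ;
        [:: 0; 0; 0; 0; 4; (-1); 0; 1; 0; 0; 4; 1; 0; 0; 0; 0; 0; 0; 0; 0; 0; 0;
       0; 0; 3; 0]%BZ;
        [:: 0; 0; 0; 1; 0; 0; 0; 0; 0; 2; 0; 0; 0; 0; 0; 0; 0; 0; 0; 0; 2; 2; 0;
       1; 0; 0]%BZ;
        [:: 0; 0; 2; 0; 0; 0; 0; 0; 12; 10; 0; 0; 3; (-1); 0; 0; 4; 0; (-2); 0;
       2; 10; 0; 2; 0; 3]%BZ;
        [:: 0; (-2); 0; 0; 0; 2; 0; 0; 0; 0; 0; 1; 0; 0; 2; (-2); 0; 0; 0; 0; 0;
       0; 0; 0; 0; 0]%BZ;
        [:: 0; 6; 0; 0; 4; 8; (-2); 3; 0; 0; 2; 0; 0; 0; 2; 3; 0; 4; 0; 0; 0; 0;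
       0; 0; 0; 0]%BZ;
        [:: 0; 0; 1; (-2); 0; 0; 0; 0; 0; 0; 0; 0; 9; 4; 0; 0; 3; 0; 1; 0; 0; 0;
       0; 1; 0; 0]%BZ;
        [:: 0; 0; 1; 0; 0; 0; 0; 0; 6; 4; 0; 0; 0; 0; 0; 0; 1; 0; 0; 0; 1; 5; 0;
       0; 0; 0]%BZ;
        [:: 0; 0; 0; 0; 0; 0; 4; 4; 0; 0; 0; 6; 0; 0; 8; (-6); 0; 4; 0; 5; 0; 0;
       4; 0; 0; 0]%BZ;
        [:: 0; 0; 0; 4; 0; 0; 0; 0; 0; 0; 0; 0; 0; 2; 0; 0; 1; 0; 1; 0; 6; 0; 0;
       0; 0; 0]%BZ;
        [:: 0; 0; 0; 0; 0; 0; 2; 0; 0; 0; 0; (-2); 0; 0; 4; 6; 0; 3; 0; 3; 0; 0;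
       0; 0; 0; 0]%BZ;
        [:: 0; 0; 0; 0; 0; 0; 0; 0; 0; 0; 0; 0; 0; 0; 0; 0; 2; 0; 4; 0; 9; 6; 0;
       2; 0; (-3)]%BZ;
        [:: 0; 0; 0; 0; 0; 0; 0; 2; 0; 0; 4; 0; 0; 0; 0; 0; 0; 3; 0; 2; 0; 0; 1;
       0; 0; 0]%BZ;
        [:: 0; 0; 0; 0; 0; 0; 1; 0; 0; 0; 6; 0; 0; 0; 0; 4; 0; 0; 0; 1; 0; 0; 1;
       0; 6; 0]%BZ;
        [:: 0; 0; 0; 0; 0; 0; 0; 0; 0; 0; 0; 0; 0; 0; 0; 0; 3; 0; (-4); 0; 4; 8;
       0; 6; 0; 12]%BZ;
        [:: 0; 0; 0; 0; 0; 0; 0; 1; 0; 0; 4; 3; 0; 0; 1; (-8); 0; 0; 0; 2; 0; 0;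
       3; 0; 0; 0]%BZ;
        [:: 0; 0; 0; 0; 0; 0; 0; 0; 2; 2; 0; 0; 0; (-1); 0; 0; 0; 0; 0; 0; (-1);
       4; 0; 0; 0; 1]%BZ;
        [:: 0; 0; 0; 0; 0; 0; 0; 0; 0; 0; 0; 2; 0; 0; 0; (-4); 0; (-1); 0; 0; 0;
       0; 2; 0; 2; 0]%BZ];
  ModuleData [:: 5; 1; 1] false [:: 0; 1; 3; 5; 6; 2; 4] 4%BZ
    [:: 5; 9]
    [:: [:: 0; 3]%BZ;
        [:: 3; 0]%BZ];
  ModuleData [:: 5; 1; 1] true [:: 0; 1; 2; 3; 5; 6; 4] 48%BZ
    [:: 3; 5; 6; 7; 8; 9; 10; 10; 11; 12; 11; 13; 12; 13; 14; 14; 14]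
    [:: [:: 0; 1; 2; 0; 0; 0; 0; 0; 0; 0; 0; 0; 0; 0; 0; 0; 0]%BZ;
        [:: 6; 0; 0; 2; 3; 2; 1; 0; 0; 0; 0; 0; 0; 0; 0; 0; 0]%BZ;
        [:: 8; 0; 0; 0; 0; 1; (-1); 5; 0; 0; 0; 0; 0; 0; 0; 0; 0]%BZ;
        [:: 0; 1; 0; 0; 0; 0; 0; 0; 2; 1; 0; 0; 0; 0; 0; 0; 0]%BZ;
        [:: 0; 4; 0; 0; 0; 0; 0; 0; 4; 0; 2; 1; 0; 0; 0; 0; 0]%BZ;
        [:: 0; 4; 3; 0; 0; 0; 0; 0; 0; (-1); 3; 0; 5; 3; 0; 0; 0]%BZ;
        [:: 0; 10; 15; 0; 0; 0; 0; 0; 0; 1; 0; 1; 0; 6; 0; 0; 0]%BZ;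
        [:: 0; 4; 9; 0; 0; 0; 0; 0; 0; 0; 0; (-1); 1; 6; 0; 0; 0]%BZ;
        [:: 0; 0; 0; 4; 3; 0; 0; 0; 0; 0; 0; 0; 0; 0; 1; 0; 0]%BZ;
        [:: 0; 0; 0; 20; 0; 5; 1; 0; 0; 0; 0; 0; 0; 0; 1; 14; 0]%BZ;
        [:: 0; 0; 0; 0; 2; 2; 0; 0; 0; 0; 0; 0; 0; 0; 4; (-14); 7]%BZ;
        [:: 0; 0; 0; 0; 15; 12; 6; 2; 0; 0; 0; 0; 0; 0; 10; (-28); 14]%BZ;
        [:: 0; 0; 0; 8; 0; 3; 0; 1; 0; 0; 0; 0; 0; 0; 3; (-7); 7]%BZ;
        [:: 0; 0; 0; 0; 6; 6; 0; 8; 0; 0; 0; 0; 0; 0; 6; (-21); 14]%BZ;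
        [:: 0; 0; 0; 0; 0; 0; 0; 0; 20; 6; 18; 4; 4; 1; 0; 0; 0]%BZ;
        [:: 0; 0; 0; 0; 0; 0; 0; 0; 4; 2; 3; 0; 0; 2; 0; 0; 0]%BZ;
        [:: 0; 0; 0; 0; 0; 0; 0; 0; 0; 0; 0; (-2); 2; 5; 0; 0; 0]%BZ];
  ModuleData [:: 4; 3] false [:: 0; 1; 2; 4; 3; 6; 5] 24%BZ
    [:: 2; 4; 6; 5; 9; 3; 9; 8; 11; 5; 7; 13; 10; 12; 14; 13]
    [:: [:: 0; 1; 2; 1; 0; 0; 0; 0; 0; 0; 0; 0; 0; 0; 0; 0]%BZ;
        [:: 4; 0; 0; 0; 3; 0; 1; 0; 0; 0; (-4); 0; 0; 0; 0; 0]%BZ;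
        [:: 4; 0; 0; 0; 1; (-3); 0; 0; 0; 0; 0; 0; 0; 0; 0; 0]%BZ;
        [:: 6; 0; 0; 0; 2; 3; 0; 4; 0; 0; (-1); 0; 0; 0; 0; 0]%BZ;
        [:: 0; 4; 3; 0; 0; 0; 0; 0; 3; 3; 0; 1; 0; 0; 0; 0]%BZ;
        [:: 0; 0; (-1); 1; 0; 0; 0; 0; 0; (-1); 0; 0; 0; 0; 0; 0]%BZ;
        [:: 0; 2; (-1); 0; 0; 0; 0; 0; (-1); (-1); 0; 0; 0; (-2); 0; 4]%BZ;
        [:: 0; 0; 0; 4; 0; 0; 0; 0; 3; (-2); 0; (-1); 0; 0; 0; 1]%BZ;
        [:: 0; 0; 0; 0; 2; 0; 0; 3; 0; 0; (-4); 0; 0; 0; (-1); 0]%BZ;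
        [:: 4; 0; 0; 0; 3; (-3); 0; 1; 0; 0; 1; 0; 1; 0; 0; 0]%BZ;
        [:: 0; (-2); 0; (-1); 0; 0; 0; 0; (-2); 1; 0; 0; 0; 1; 0; 0]%BZ;
        [:: 0; 0; 0; 0; 10; 0; 6; (-8); 0; 0; 0; 0; 4; 0; (-1); 0]%BZ;
        [:: 0; 0; 0; (-4); 0; 0; 0; 0; 0; 6; 0; 2; 0; 1; 0; (-1)]%BZ;
        [:: 0; 0; 0; 0; (-1); 0; (-3); 0; 0; 0; 10; 0; 1; 0; 5; 0]%BZ;
        [:: 0; 0; 0; 0; 0; 0; 0; 0; (-4); 0; 0; 1; 0; 4; 0; (-4)]%BZ;
        [:: 0; 0; 0; 0; 4; 0; 4; (-1); 0; 0; 0; 0; 1; 0; (-2); 0]%BZ];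
  ModuleData [:: 4; 3] true [:: 0; 2; 4; 5; 3; 6; 1] 3%BZ
    [:: 13; 14]
    [:: [:: 0; 1]%BZ;
        [:: 9; 0]%BZ];
  ModuleData [:: 4; 2; 1] false [:: 0; 1; 2; 4; 3; 6; 5] 12%BZ
    [:: 2; 5; 8; 7; 11; 9; 13; 12; 10; 9; 4; 9; 13; 10; 13; 14; 6; 14; 14;
      12; 5]
    [:: [:: 0; 1; 0; 0; 0; 0; 0; 0; 0; 0; 1; 0; 0; 0; 0; 0; 1; 0; 0; 0; 0]%BZ;
        [:: 12; 0; 8; 2; 0; 8; 0; 0; 3; 0; 0; 0; 0; 0; 0; 0; 0; 0; 0; 0; 0]%BZ;
        [:: 0; 2; 0; 0; 0; 0; 1; 0; 0; 0; 0; 0; 1; 0; (-1); 0; 0; 0; 0; 0; 4]%BZ;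
        [:: 0; (-1); 0; 0; 1; 0; 0; 1; 0; 0; (-2); 0; 0; 0; 0; 0; 0; 0; 0; 0;
       (-4)]%BZ;
        [:: 0; 0; 0; 2; 0; 0; 0; 0; 0; 2; 0; 0; 0; 0; 0; (-1); 0; 1; 0; 0; 0]%BZ;
        [:: 0; 0; 0; 0; 0; 0; 1; 0; 0; 0; 4; 0; 0; 0; 0; 0; 0; 0; 0; 0; (-3)]%BZ;
        [:: 0; 0; 8; 0; 0; 10; 0; 0; 4; (-6); 0; 6; 0; 0; 0; 1; 0; 0; 0; 0; 0]%BZ;
        [:: 0; 0; 0; 4; 0; (-1); 0; 0; 1; 0; 0; (-3); 0; 0; 0; 0; 0; (-2); 2; 0;
       0]%BZ;
        [:: 0; 2; 0; 0; 0; 0; 3; 1; 0; 0; 0; 0; 1; 0; 0; 0; 6; 0; 0; 0; 0]%BZ;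
        [:: 0; 0; 0; 0; 3; 0; 0; (-2); 0; 0; (-2); 0; 3; 0; (-4); 0; (-3); 0; 0;
       (-1); 0]%BZ;
        [:: 1; 0; 0; (-1); 0; 3; 0; 0; 0; (-1); 0; 1; 0; 0; 0; 0; 0; 0; 0; 0;
       0]%BZ;
        [:: 0; 0; 0; 0; 2; 0; 0; (-2); 0; 0; 0; 0; (-1); 0; 0; 0; (-2); 0; 0; 0;
       1]%BZ;
        [:: 0; 0; 0; 0; 0; (-5); 0; 0; 4; 4; 0; (-7); 0; 6; 0; 1; 0; (-4); 4; 0;
       0]%BZ;
        [:: 0; (-1); 0; 0; 0; 0; (-2); 0; 0; 0; 0; 0; (-2); 0; 4; 0; 0; 0; 0; 1;
       0]%BZ;
        [:: 0; 0; 1; 0; 0; (-1); 0; 0; 5; 0; 0; (-3); 0; 6; 0; 2; 0; (-3); 3; 0;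
       0]%BZ;
        [:: 0; 0; 0; 0; (-5); 0; 0; 5; 0; 0; 0; 0; (-4); 0; 8; 0; 0; 0; 0; 6;
       0]%BZ;
        [:: 2; 0; 0; 0; 0; 0; 0; 0; 2; (-1); 0; 0; 0; 1; 0; 0; 0; 0; 0; 0; 0]%BZ;
        [:: 0; 0; 0; 0; 5; 0; 1; 0; 0; 0; 0; 0; 4; 0; (-4); 0; 0; 0; 0; (-2);
       0]%BZ;
        [:: 0; 0; 0; 0; 4; 0; 2; 3; 0; 0; 0; 0; 5; 0; (-2); 0; 0; 0; 0; (-1);
       0]%BZ;
        [:: 0; 0; 0; (-2); 0; 1; 0; 0; 0; (-2); 0; 3; 0; 1; 0; 4; 0; 5; (-4); 0;
       0]%BZ;
        [:: (-4); 0; (-2); (-1); 0; (-3); 0; 0; (-1); 0; 0; 0; 0; 0; 0; 0; 0; 0;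
       0; 0; 0]%BZ];
  ModuleData [:: 4; 2; 1] true [:: 0; 1; 2; 4; 5; 6; 3] 6%BZ
    [:: 6; 10; 13; 12; 8; 13; 5; 14; 11; 9; 14; 13; 9; 10; 12]
    [:: [:: 0; 1; 0; 0; 0; 0; 0; 0; 0; (-1); 0; 0; 0; 0; 0]%BZ;
        [:: 10; 0; 12; 1; 0; 0; 5; 0; 0; 0; 0; 0; 0; 0; 0]%BZ;
        [:: 0; 1; 0; 0; 3; 0; 0; 0; 0; 2; 0; 0; 2; 0; 0]%BZ;
        [:: 0; 1; 0; 0; 0; 0; 0; (-6); 0; (-10); 3; 0; (-5); 0; 0]%BZ;
        [:: 0; 0; 3; 0; 0; 2; 1; 0; 1; 0; 0; 0; 0; 0; 0]%BZ;
        [:: 0; 1; 0; 0; 3; 0; 0; 1; 0; 0; 0; 0; 0; 4; 0]%BZ;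
        [:: 0; 3; 0; 0; 4; 0; 0; 0; 0; 4; 0; 0; 2; 5; 0]%BZ;
        [:: 0; 0; (-2); 1; 0; 6; 0; 0; 5; 0; 0; 4; 0; 0; 7]%BZ;
        [:: 0; 0; 0; 0; 4; 0; 0; 1; 0; 2; 3; 0; 0; 0; 0]%BZ;
        [:: (-3); 0; (-6); (-1); 0; 1; 2; 0; 3; 0; 0; 3; 0; 0; 0]%BZ;
        [:: 0; 0; (-1); 0; 0; 3; 0; 0; 3; 0; 0; 2; 0; 0; 2]%BZ;
        [:: 0; 3; 0; 0; 1; 0; 0; 2; 0; 6; 0; 0; 3; 4; 0]%BZ;
        [:: 4; 0; 15; 0; 0; 2; 0; 0; (-4); 0; 0; (-3); 0; 0; 0]%BZ;
        [:: (-4); 0; (-5); 0; 0; 2; (-1); 0; 0; 0; 0; 1; 0; 0; 1]%BZ;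
        [:: 0; 0; 0; 0; 0; 0; 0; 4; 0; 4; (-3); 0; 2; 1; 0]%BZ];
  ModuleData [:: 3; 2; 2] true [:: 0; 3; 4; 1; 5; 6; 2] 1%BZ
    [:: 9; 13]
    [:: [:: 0; 3]%BZ;
        [:: 3; 0]%BZ];
  ModuleData [:: 4; 1; 1; 1] true [:: 0; 1; 2; 3; 5; 6; 4] 144%BZ
    [:: 3; 5; 6; 7; 8; 9; 10; 10; 11; 12; 11; 13; 5; 12; 13; 13; 14; 9; 8]
    [:: [:: 0; 1; 1; 0; 0; 0; 0; 0; 0; 0; 0; 0; 0; 0; 0; 0; 0; 0; 0]%BZ;
        [:: 6; 0; 0; 2; 3; 1; 1; 0; 0; 0; 0; 0; 0; 0; 0; 0; 0; 0; 0]%BZ;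
        [:: 9; 0; 0; 0; 0; 1; 2; 2; 0; 0; 0; 0; 0; 0; 0; 0; 0; 0; 0]%BZ;
        [:: 0; 1; 0; 0; 0; 0; 0; 0; 2; 1; 0; 0; 0; 0; 0; 0; 0; 0; 0]%BZ;
        [:: 0; 4; 0; 0; 0; 0; 0; 0; 4; 0; 1; 1; 0; 0; 0; 0; 0; 0; 0]%BZ;
        [:: 0; 3; 3; 0; 0; 0; 0; 0; 0; 2; 3; 2; 1; 2; 1; 0; 0; 0; 0]%BZ;
        [:: 0; 6; 4; 0; 0; 0; 0; 0; 0; 1; 0; 3; (-2); 0; 1; 0; 0; 0; 0]%BZ;
        [:: 0; 0; 4; 0; 0; 0; 0; 0; 0; 0; 0; 0; 0; 1; 2; 3; 0; 0; 0]%BZ;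
        [:: 0; 0; 0; 4; 3; 0; 0; 0; 0; 0; 0; 0; 0; 0; 0; 0; 1; 0; 0]%BZ;
        [:: 0; 0; 0; 6; 0; 0; 1; 0; 0; 0; 0; 0; 0; 0; 0; 0; 1; 1; 0]%BZ;
        [:: 0; 0; 0; 0; 0; 2; 0; 0; 0; 0; 0; 0; 0; 0; 0; 0; 1; 0; 1]%BZ;
        [:: 0; 0; 0; 0; 9; 4; 4; (-1); 0; 0; 0; 0; 0; 0; 0; 0; 3; (-2); (-2)]%BZ;
        [:: 9; 0; 0; 3; 0; 0; (-2); 0; 0; 0; 0; 0; 0; 0; 0; 0; 0; 2; 2]%BZ;
        [:: 0; 0; 0; 0; 0; 0; 0; 1; 0; 0; 0; 0; 0; 0; 0; 0; (-1); 1; 0]%BZ;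
        [:: 0; 0; 0; 0; 0; 4; 0; 6; 0; 0; 0; 0; 0; 0; 0; 0; (-5); (-2); (-2)]%BZ;
        [:: 0; 0; 0; 0; 0; 0; 1; 0; 0; 0; 0; 0; 0; 0; 0; 0; 2; 0; 1]%BZ;
        [:: 0; 0; 0; 0; 0; 0; 0; 0; 6; 2; 2; 2; 0; (-2); (-1); 0; 0; 0; 0]%BZ;
        [:: 0; 0; 4; 0; 0; 0; 0; 0; 0; 5; 4; (-2); 4; 5; (-1); 0; 0; 0; 0]%BZ;
        [:: 0; 6; 0; 0; 0; 0; 0; 0; 9; 0; 4; (-2); 2; 0; (-1); 3; 0; 0; 0]%BZ];
  ModuleData [:: 3; 3; 1] false [:: 0; 1; 3; 2; 5; 6; 4] 4%BZ
    [:: 5; 10; 12; 13; 9]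
    [:: [:: 0; 1; 0; 0; 0]%BZ;
        [:: 6; 0; 1; 1; 0]%BZ;
        [:: 0; 1; 0; 0; 3]%BZ;
        [:: 0; 2; 0; 0; (-3)]%BZ;
        [:: 0; 0; 2; (-1); 0]%BZ];
  ModuleData [:: 3; 3; 1] true [:: 1; 0; 3; 6; 5; 4; 2] 8%BZ
    [:: 7; 5; 10; 12; 9; 13; 14; 10; 11; 12; 14; 13; 14]
    [:: [:: 0; 1; 0; 5; 0; 0; 0; 0; 1; 0; 0; 0; 0]%BZ;
        [:: 2; 0; 5; 0; 2; 0; 0; 0; 0; 0; 0; 0; 0]%BZ;
        [:: 0; 2; 0; 1; 0; 1; 0; 0; 0; 0; 0; 0; 0]%BZ;
        [:: 4; 0; 1; 0; 1; 0; 2; 0; 0; 0; 0; 0; 0]%BZ;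
        [:: 0; 4; 0; 10; 0; 3; 0; 0; 0; (-10); 0; 0; 0]%BZ;
        [:: 0; 0; 0; 0; 3; 0; 8; 10; 0; 0; 4; 0; 0]%BZ;
        [:: 0; 0; 0; 11; 0; 2; 0; 0; 5; 1; 0; (-1); 0]%BZ;
        [:: 0; 1; 0; 0; 0; 1; 0; 0; 0; 1; 0; 0; 0]%BZ;
        [:: 2; 0; 0; 0; 0; 0; 1; 0; 0; 0; (-5); 0; 8]%BZ;
        [:: 2; 0; 0; 0; 0; 0; (-1); 1; 0; 0; (-1); 0; (-1)]%BZ;
        [:: 0; 0; 0; (-12); 0; (-1); 0; 0; (-9); (-7); 0; 2; 0]%BZ;
        [:: 0; 0; 0; 0; (-3); 0; (-6); (-10); 0; 0; (-4); 0; 3]%BZ;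
        [:: 0; 0; 0; (-7); 0; 0; 0; 0; (-3); (-2); 0; 2; 0]%BZ];
  ModuleData [:: 3; 2; 2] false [:: 0; 1; 2; 4; 3; 6; 5] 96%BZ
    [:: 2; 4; 5; 6; 7; 9; 10; 9; 10; 11; 12; 12; 13; 13; 13; 14; 14; 14; 8;
      11]
    [:: [:: 0; 1; 1; 1; 0; 0; 0; 0; 0; 0; 0; 0; 0; 0; 0; 0; 0; 0; 0; 0]%BZ;
        [:: 5; 0; 0; 0; 5; 1; 0; 0; 0; 0; 0; 0; 0; 0; 0; 0; 0; 0; 0; 0]%BZ;
        [:: 4; 0; 0; 0; 2; 0; 1; 0; 0; 0; 0; 0; 0; 0; 0; 0; 0; 0; 0; 0]%BZ;
        [:: 2; 0; 0; 0; 0; 1; 0; 1; 1; 0; 0; 0; 0; 0; 0; 0; 0; 0; 0; 0]%BZ;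
        [:: 0; 2; 1; 0; 0; 0; 0; 0; 0; 1; 1; 0; 0; 0; 0; 0; 0; 0; 0; 0]%BZ;
        [:: 0; 6; 0; 5; 0; 0; 0; 0; 0; 5; 2; 1; 1; 0; 0; 0; 0; 0; 0; 0]%BZ;
        [:: 0; 0; 6; 6; 0; 0; 0; 0; 0; 0; 1; 0; (-1); 3; 0; 0; 0; 0; 0; 0]%BZ;
        [:: 0; (-4); 0; (-2); 0; 0; 0; 0; 0; (-2); (-2); 0; (-1); 1; 0; 0; 0; 0;
       0; 0]%BZ;
        [:: 0; 0; 3; 8; 0; 0; 0; 0; 0; 0; 0; 1; (-2); 4; 2; 0; 0; 0; 0; 0]%BZ;
        [:: 0; 0; 0; 0; 2; 2; 0; 2; 0; 0; 0; 0; 0; 0; 0; 1; 0; 0; 0; 0]%BZ;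
        [:: 0; 0; 0; 0; 12; 0; 1; (-3); 0; 0; 0; 0; 0; 0; 0; 5; 1; 0; 0; 0]%BZ;
        [:: 0; 0; 0; 0; 6; 2; 0; 1; 1; 0; 0; 0; 0; 0; 0; 0; (-2); 1; 0; 0]%BZ;
        [:: 0; 0; 0; 0; 0; 6; 0; 0; 0; 0; 0; 0; 0; 0; 0; 5; 0; (-1); 6; 0]%BZ;
        [:: 0; 0; 0; 0; 0; 4; 0; 3; 2; 0; 0; 0; 0; 0; 0; 1; (-2); 1; 2; 0]%BZ;
        [:: 0; 0; 0; 0; 0; 2; (-2); 0; 4; 0; 0; 0; 0; 0; 0; 0; (-5); 3; 3; 0]%BZ;
        [:: 0; 0; 0; 0; 0; 0; 0; 0; 0; 6; 3; 0; 1; 0; 0; 0; 0; 0; 0; 4]%BZ;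
        [:: 0; 0; 0; 0; 0; 0; 0; 0; 0; (-12); (-1); (-6); (-1); (-2); (-2); 0;
       0; 0; 0; (-12)]%BZ;
        [:: 0; 0; 0; 0; 0; 0; 0; 0; 0; (-15); (-2); (-6); (-3); 0; 0; 0; 0; 0;
       0; (-14)]%BZ;
        [:: 0; 0; 0; 0; 0; 0; 0; 0; 0; 0; 0; 0; 1; 0; 3; 0; 0; 0; 0; 4]%BZ;
        [:: 0; 0; 0; 0; 0; 0; 0; 0; 0; 0; 0; 0; 0; 0; 0; 0; (-5); 2; 2; 0]%BZ];
  ModuleData [:: 3; 2; 1; 1] false [:: 0; 3; 4; 1; 5; 6; 2] 1%BZ
    [:: 9; 12; 13; 10; 14; 11; 13; 14]
    [:: [:: 0; 1; 1; 0; 0; 0; 0; 0]%BZ;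
        [:: 2; 0; 0; 1; 1; 0; 0; 0]%BZ;
        [:: 3; 0; 0; (-3); 0; 0; 0; 0]%BZ;
        [:: 0; 1; (-2); 0; 0; 0; 0; 0]%BZ;
        [:: 0; 4; (-1); 0; 0; 1; 3; 0]%BZ;
        [:: 0; 0; 0; 0; (-3); 0; 0; 9]%BZ;
        [:: 1; 0; 0; (-1); 2; 0; 0; (-3)]%BZ;
        [:: 0; 2; 0; 0; 0; 1; 0; 0]%BZ];
  ModuleData [:: 3; 2; 1; 1] true [:: 0; 1; 2; 4; 5; 6; 3] 24%BZ
    [:: 6; 9; 10; 5; 11; 12; 13; 5; 8; 9; 10; 14; 7; 9; 14; 13; 12; 13; 11;
      14]
    [:: [:: 0; 1; 1; 0; 0; 0; 0; 0; 0; 0; 0; 0; 0; 0; 0; 0; 0; 0; 0; 0]%BZ;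
        [:: 3; 0; 0; 1; 3; 1; 1; 0; 0; 0; 0; 0; 0; 0; 0; 0; 0; 0; 0; 0]%BZ;
        [:: 4; 0; 0; (-2); 0; 1; 0; 2; 0; 0; 0; 0; 0; 0; 0; 0; 0; 0; 0; 0]%BZ;
        [:: 0; 3; 0; 0; 0; 0; 0; 0; 2; 1; 4; 0; 0; 0; 0; 0; 0; 0; 0; 0]%BZ;
        [:: 0; 2; 0; 0; 0; 0; 0; 0; 1; 0; 0; 1; 0; 0; 0; 0; 0; 0; 0; 0]%BZ;
        [:: 0; 0; 1; 0; 0; 0; 0; 0; 0; 2; 0; 1; 2; 2; 1; 0; 0; 0; 0; 0]%BZ;
        [:: 0; 6; 2; 0; 0; 0; 0; 0; 0; 0; 4; 2; 0; (-2); 1; 0; 0; 0; 0; 0]%BZ;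
        [:: 0; 0; 0; 0; 0; 0; 0; 0; 1; 2; (-1); 0; 1; 2; 0; 0; 0; 0; 0; 0]%BZ;
        [:: 0; 0; 0; 2; 4; 0; 1; 0; 0; 0; 0; 0; 0; 0; 0; 1; 0; 0; 0; 0]%BZ;
        [:: (-1); 0; 0; 0; (-1); 5; 1; 4; 0; 0; 0; 0; 0; 0; 0; 0; 0; 0; 0; 0]%BZ;
        [:: (-2); 0; 0; 2; 0; 0; 1; (-2); 0; 0; 0; 0; 0; 0; 0; 0; 1; 1; 0; 0]%BZ;
        [:: 0; 0; 0; 0; 8; 2; 3; 0; 0; 0; 0; 0; 0; 0; 0; 2; (-2); (-2); 2; 0]%BZ;
        [:: 0; 0; 0; (-1); 0; 0; 0; 2; 0; 0; 0; 0; 0; 0; 0; 0; (-6); 0; 1; 0]%BZ;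
        [:: 3; 0; 0; 0; 3; 0; (-1); 0; 0; 0; 0; 0; 0; 0; 0; 1; 0; (-3); 0; 0]%BZ;
        [:: 0; 0; 0; 0; (-2); 4; (-2); 0; 0; 0; 0; 0; 0; 0; 0; 0; 2; (-4); 1;
       0]%BZ;
        [:: 0; (-6); 2; 0; 0; 0; 0; 0; 3; 0; 4; 2; 0; 2; (-5); 0; 0; 0; 0; 4]%BZ;
        [:: 0; 0; 0; 0; 0; 0; 0; 0; 0; (-1); 1; 0; (-2); (-1); (-1); 0; 0; 0; 0;
       1]%BZ;
        [:: 0; (-2); 1; 0; 0; 0; 0; 0; 1; (-1); 2; 0; 0; (-1); (-3); 0; 0; 0; 0;
       2]%BZ;
        [:: 0; 0; 0; 0; 0; 0; 0; 0; 0; 0; 0; 3; 2; 0; 0; 0; 0; 0; 0; 2]%BZ;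
        [:: 0; 0; 0; 0; (-6); 3; (-2); 0; 0; 0; 0; 0; 0; 0; 0; (-1); 6; 0; 0;
       0]%BZ];
  ModuleData [:: 3; 1; 1; 1; 1] false [:: 0; 3; 4; 5; 6; 1; 2] 4%BZ
    [:: 8; 11; 13; 14; 10; 14; 12; 13; 14]
    [:: [:: 0; 2; 1; 0; 0; 0; 0; 0; 0]%BZ;
        [:: 4; 0; 0; 7; 0; 0; 0; 0; 0]%BZ;
        [:: 3; 0; 0; 7; 6; 7; 0; 0; 0]%BZ;
        [:: 0; 2; 1; 0; 0; 0; 2; 1; 0]%BZ;
        [:: 0; 0; 2; 0; 0; 0; 1; 0; 0]%BZ;
        [:: 0; 0; 1; 0; 0; 0; 0; (-1); 0]%BZ;
        [:: 0; 0; 0; 7; 1; 0; 0; 0; 7]%BZ;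
        [:: 1; 0; 0; 2; 2; 2; 0; 0; (-1)]%BZ;
        [:: 0; (-1); 0; 0; 0; 0; 0; (-2); 0]%BZ];
  ModuleData [:: 3; 1; 1; 1; 1] true [:: 0; 2; 3; 1; 5; 6; 4] 6%BZ
    [:: 8; 13; 5; 9]
    [:: [:: 0; 1; 2; 0]%BZ;
        [:: 3; 0; 0; 0]%BZ;
        [:: 2; 0; 0; 1]%BZ;
        [:: 0; 0; 3; 0]%BZ];
  ModuleData [:: 2; 2; 2; 1] false [:: 0; 2; 1; 4; 3; 6; 5] 12%BZ
    [:: 4; 9; 12; 13; 10; 14; 8; 13; 11]
    [:: [:: 0; 1; 0; 0; 0; 0; 0; 0; 0]%BZ;
        [:: 6; 0; 1; 1; 0; 0; 0; 0; 0]%BZ;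
        [:: 0; 2; 0; 0; 1; 2; 0; 0; 0]%BZ;
        [:: 0; 6; 0; 0; 0; 3; 6; 0; 0]%BZ;
        [:: 0; 0; 1; 1; 0; 0; 0; 3; 0]%BZ;
        [:: 0; 0; 2; 1; 0; 0; 0; 0; 2]%BZ;
        [:: 0; 0; 0; 1; 0; 0; 0; (-3); 1]%BZ;
        [:: 0; (-2); 0; 0; 1; (-1); (-3); 0; 0]%BZ;
        [:: 0; 0; 0; 0; 0; 6; 3; 0; 0]%BZ];
  ModuleData [:: 2; 2; 2; 1] true [:: 0; 2; 1; 4; 5; 6; 3] 4%BZ
    [:: 9; 13; 14]
    [:: [:: 0; 1; 0]%BZ;
        [:: 4; 0; 1]%BZ;
        [:: 0; 5; 0]%BZ];
  ModuleData [:: 2; 2; 1; 1; 1] false [:: 0; 2; 4; 5; 1; 6; 3] 6%BZ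
    [:: 8; 11; 13]
    [:: [:: 0; 2; 1]%BZ;
        [:: 3; 0; 0]%BZ;
        [:: 3; 0; 0]%BZ];
  ModuleData [:: 2; 2; 1; 1; 1] true [:: 1; 0; 3; 2; 5; 6; 4] 48%BZ
    [:: 7; 11; 14; 5; 9; 13; 14]
    [:: [:: 0; 1; 0; 1; 0; 0; 0]%BZ;
        [:: 2; 0; 1; 0; 0; 0; 0]%BZ;
        [:: 0; 6; 0; 0; 0; (-1); 0]%BZ;
        [:: 2; 0; 0; 0; 1; 0; 0]%BZ;
        [:: 0; 0; 0; 3; 0; 2; 0]%BZ;
        [:: 0; 0; 0; 0; 2; 0; 1]%BZ;
        [:: 0; (-3); 0; 0; 0; 2; 0]%BZ];
  ModuleData [:: 2; 1; 1; 1; 1; 1] false [:: 0; 2; 3; 1; 5; 6; 4] 6%BZ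
    [:: 8; 11; 13; 10; 12]
    [:: [:: 0; 1; 1; 0; 0]%BZ;
        [:: 1; 0; 0; 0; 0]%BZ;
        [:: 3; 0; 0; 5; 0]%BZ;
        [:: 0; 0; 1; 0; 1]%BZ;
        [:: 0; 0; 0; 1; 0]%BZ];
  ModuleData [:: 1; 1; 1; 1; 1; 1; 1] true [:: 1; 2; 3; 4; 5; 6; 0] 14%BZ
    [:: 14]
    [:: [:: 0]%BZ];
  ModuleData [:: 4; 1; 1; 1] false [:: 0; 2; 4; 5; 3; 6; 1] 1%BZ
    [:: 13; 14]
    [:: [:: 0; 1]%BZ;
        [:: 9; 0]%BZ]].

Definition zsum (s : seq Z) : Z := foldr Z.add 0%BZ s.
Definition num_rows (d : module_data) := size (row_class d).
Definition act_entry (d : module_data) r s : Z := nth 0%BZ (nth [::] (trans_mx d) r) s.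
Definition row_no d r := nth 0 (row_class d) r.
Definition class_rows d i := [seq r <- iota 0 (num_rows d) | eqn (row_no d r) i].

Section Build.

Let members : seq (seq code) :=
  foldr (fun u ms => let i := cycle_type u in
                     set_nth [::] ms i (u :: nth [::] ms i))
        (nseq 15 [::]) codes.
Let transpositions := nth [::] members 1.
Let tval (t : trie Z) u : Z := if tget t u is Some z then z else 0%BZ.
Let tabulate i (f : code -> Z) : trie Z :=
  foldl (fun t u => tset t u (f u)) Tip (nth [::] members i).

Definition block_perms (b : seq nat) : seq code :=
  [seq [seq (if a \in b then nth 0 p (index a b) else a) | a <- code1]
     | p <- permutations b].

Definition young_subgroup (bs : seq (seq nat)) : seq code :=
  foldr (fun b us => flatten [seq [seq codeM v u | u <- us] | v <- block_perms b])
        [:: code1] bs.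

Fixpoint code_odd (u : code) : bool :=
  if u is a :: u' then odd (count (fun b => b < a) u') (+) code_odd u' else false.

(** The Young symmetrizer, made even or odd under inversion, has rank one on the
    chosen irreducible representation of H and kills the others, so its image on
    the functions on G is a copy of the multiplicity space.  That the rows obtained
    span a module is established by the checks below. *)
Definition seed_row (d : module_data) : trie Z :=
  let row_blocks := reshape (young_shape d) code1 in
  let col_blocks := [seq [seq nth 0 r j | r <- row_blocks & j < size r]
                       | j <- iota 0 (head 0 (young_shape d))] in
  let bump (t : trie Z) u z := tset t u (tval t u + z)%BZ in
  let t := foldl (fun t g => foldl (fun t h =>
    let u := codeJ (codeJ (seed_pt d) g) h in
    let z := (if code_odd h then -1 else 1)%BZ in
    bump (bump t u z) (codeV u) (if odd_inv d then - z else z)%BZ)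
    t (young_subgroup col_blocks)) Tip (young_subgroup row_blocks) in
  tabulate (row_no d 0) (fun u => tval t u / seed_content d)%BZ.

Definition parent d r :=
  find (fun s => if Z.eqb (act_entry d s r) 0 then false else
     all (fun r' => Z.eqb (act_entry d s r') 0)
         [seq r' <- class_rows d (row_no d r) | r < r']) (iota 0 r).

(** Solves for row r in the equation that describes A on its parent row. *)
Definition next_row d basis r : trie Z :=
  let s := parent d r in
  let prev := nth Tip basis s in
  let corr := [seq (act_entry d s r', nth Tip basis r')
                 | r' <- class_rows d (row_no d r) & r' < r] in
  tabulate (row_no d r) (fun u =>
    (zsum [seq tval prev (codeM u v) | v <- transpositions] -
     zsum [seq p.1 * tval p.2 u | p <- corr]) / act_entry d s r)%BZ.

Definition module_basis d : seq (trie Z) :=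
  foldl (fun rs r => rcons rs (next_row d rs r)) [:: seed_row d]
        (iota 1 (num_rows d).-1).

(** At each permutation, the number of its class and, for each module, the values
    of the rows that live in that class. *)
Definition build_table : trie (nat * seq (seq Z)) :=
  let rs := [seq (d, module_basis d) | d <- modules] in
  foldl (fun t i =>
    let sel := [seq [seq nth Tip p.2 r | r <- class_rows p.1 i] | p <- rs] in
    foldl (fun t u => tset t u (i, [seq [seq tval row u | row <- ts] | ts <- sel]))
          t (nth [::] members i))
    Tip (iota 0 15).

End Build.

Definition module_table : trie (nat * seq (seq Z)) := Eval vm_compute in build_table.

Definition nth_module k :=
  nth (ModuleData [::] false [::] 0%BZ [::] [::]) modules k.
Definition table_row u :=
  if tget module_table u is Some p then p else (0, [::]).
Definition class_no u := (table_row u).1.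
Definition module_val k r u : Z :=
  let l := table_row u in
  let d := nth_module k in
  if eqn l.1 (row_no d r)
  then nth 0%BZ (nth [::] l.2 k) (index r (class_rows d l.1)) else 0%BZ.
Definition transpositions : seq code :=
  Eval vm_compute in [seq u <- codes | eqn (class_no u) 1].
Definition class_rep i : code := nth [::] class_reps i.

(** * The finite checks *)

Definition is_code (w : code) :=
  [&& eqn (size w) 7, all (fun a => a < 7) w & uniq w].

(** The numbers of the table are those of the conjugacy classes: an element of
    class i is conjugate to the representative of class i, and conversely. *)
Definition class_check (u : code) :=
  [&& class_no u < 15, is_code (cycle_word u),
      code_eq (codeM (cycle_word u) u)
              (codeM (class_rep (class_no u)) (cycle_word u)) &
      eqn (class_no (codeV u)) (class_no u)].
Definition rep_check i :=
  is_code (class_rep i) &&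
  all (fun h => eqn (class_no (codeJ (class_rep i) h)) i) codes.

Fixpoint zdot (u v : seq Z) : Z :=
  match u, v with
  | a :: u', b :: v' => (a * b + zdot u' v')%BZ
  | _, _ => 0%BZ
  end.
Fixpoint zadd_seq (u v : seq Z) : seq Z :=
  match u, v with
  | a :: u', b :: v' => (a + b)%BZ :: zadd_seq u' v'
  | [::], _ => v
  | _, [::] => u
  end.
Fixpoint zadd_mat (u v : seq (seq Z)) :=
  match u, v with
  | a :: u', b :: v' => zadd_seq a b :: zadd_mat u' v'
  | [::], _ => v
  | _, [::] => u
  end.
Fixpoint zeq_seq (u v : seq Z) : bool :=
  match u, v with
  | a :: u', b :: v' => if Z.eqb a b then zeq_seq u' v' else false
  | [::], [::] => true
  | _, _ => false
  end.
Fixpoint zeq_mat (u v : seq (seq Z)) : bool :=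
  match u, v with
  | a :: u', b :: v' => if zeq_seq a b then zeq_mat u' v' else false
  | [::], [::] => true
  | _, _ => false
  end.
Fixpoint act_blocks (B : seq (seq (seq Z))) (v : seq (seq Z)) :=
  match B, v with
  | b :: B', x :: v' => [seq zdot r x | r <- b] :: act_blocks B' v'
  | _, _ => [::]
  end.

(** For each module, the block of the matrix of A with rows in class i and columns
    in class j.  It is empty when all these blocks vanish, to match the empty sum
    over neighbours when no transposition leads from class j to class i. *)
Definition blocks i j : seq (seq (seq Z)) :=
  let B := [seq [seq [seq act_entry d r s | s <- class_rows d j]
                   | r <- class_rows d i] | d <- modules] in
  if all (all (all (Z.eqb 0))) B then [::] else B.
Definition block_table := Eval vm_compute in
  [seq [seq blocks i j | i <- iota 0 15] | j <- iota 0 15].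

(** Column u of P A = M P, for all modules at once: the rows of class i are summed
    over the neighbours of u that lie in class i. *)
Definition stable_check u :=
  let nb := [seq table_row (codeM u t) | t <- transpositions] in
  let l := table_row u in
  all (fun ib => zeq_mat (foldr zadd_mat [::] [seq p.2 | p <- nb & eqn p.1 ib.1])
                         (act_blocks ib.2 l.2))
    (zip (iota 0 15) (nth [::] block_table l.1)).

Definition class_consts : seq (seq nat) := Eval vm_compute in
  [seq [seq count (fun t => eqn (class_no (codeM t (class_rep l))) j) transpositions
          | j <- iota 0 15] | l <- iota 0 15].
Definition class_const j l := nth 0 (nth [::] class_consts l) j.
Definition class_const_check z :=
  let nb := [seq class_no (codeM t z) | t <- transpositions] in
  code_eq [seq count (fun c => eqn c j) nb | j <- iota 0 15]
          (nth [::] class_consts (class_no z)).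

Definition code_commuting g :=
  count (fun x => code_eq (codeM x g) (codeM g x)) codes.
Definition code_inverting g :=
  count (fun x => code_eq (codeM (codeM x g) x) g) codes.
Definition burnside_term i : Z :=
  let a := Z.of_nat (code_commuting (class_rep i)) in
  let b := Z.of_nat (code_inverting (class_rep i)) in
  (Z.of_nat (count (fun u => eqn (class_no u) i) codes) * (a * a + b * b))%BZ.
Definition burnside_sum : Z := zsum [seq burnside_term i | i <- iota 0 15].
Definition burnside_total := 40753440%BZ.
Definition burnside_orbits := 4043%BZ.
Definition order7 := 5040%BZ.

Definition seed_check k :=
  let d := nth_module k in code_eq (class_rows d (row_no d 0)) [:: 0].
Definition tree_check k :=
  let d := nth_module k in
  all (fun r => has (fun s => if Z.eqb (act_entry d s r) 0 then false else
         all (fun q => if q <= r then true else Z.eqb (act_entry d s q) 0)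
             (class_rows d (row_no d r))) (iota 0 r))
      (iota 1 (num_rows d).-1).

(** Within a class, the rows are in echelon form for suitable pivots. *)
Definition pivot_check k :=
  let d := nth_module k in
  all (fun r => let later := [seq q <- class_rows d (row_no d r) | r < q] in
         has (fun u => if Z.eqb (module_val k r u) 0 then false else
                all (fun q => Z.eqb (module_val k q u) 0) later) codes)
      (iota 0 (num_rows d)).

(** The predecessors of the sizes of the blocks. *)
Definition block_dims : seq nat :=
  [:: 14; 14; 25; 1; 16; 15; 1; 20; 14; 1; 18; 4; 12; 19; 7; 19; 8; 3; 8; 2; 2;
      6; 4; 0].
Definition num_rows_check :=
  code_eq (map num_rows modules) (rcons (map succn block_dims) 2).
Definition row_no_check := all (fun d => all (fun c => c < 15) (row_class d)) modules.

(** Modules are grouped by the class of their seed, and the groups ordered so that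
    a module has at most one row in the seed class of any earlier one.
    The class companion i separates the modules whose seed is in class i. *)
Definition separation_order : seq nat :=
  [:: 0; 1; 2; 5; 7; 13; 4; 10; 18; 8; 15; 12; 21; 16; 17; 20; 22; 3; 11; 9; 14;
      19; 6; 23].
Definition companion i := nth 0 [:: 0; 2; 4; 6; 0; 9; 10; 12; 11; 13] i.
Definition weight k r j :=
  let d := nth_module k in
  zsum [seq (act_entry d r q * act_entry d q r)%BZ | q <- class_rows d j].
Definition separated k l :=
  let i := row_no (nth_module k) 0 in
  match class_rows (nth_module l) i with
  | [::] => true
  | [:: r] => ~~ Z.eqb (weight k 0 (companion i)) (weight l r (companion i))
  | _ => false
  end.
Definition separation_check :=
  pairwise separated separation_order &&
  all (fun k => k \in separation_order) (iota 0 24).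

(** Row k holds the coefficients b, d, mu, nu that express the action of class k on
    a row space where the square of A is 9. *)
Definition central_cert : seq (seq Z * (Z * Z * Z)) := [::
  ([:: 0; 0; 0; 0; 0; 0; 0; 0; 0; 0; 0; 0; 0; 0; 0],
     (1, 1, 0))%BZ;
  ([:: 0; 0; 0; 0; 0; 0; 0; 0; 0; 0; 0; 0; 0; 0; 0],
     (1, 0, 1))%BZ;
  ([:: (-215590); 0; (-15514); 39374; 0; 0; 0; 12806; 25058; 0; (-10375); 0; 0; 0; (-7203)],
     (807840, (-2423520), 0))%BZ;
  ([:: 619510; 0; 15514; (-39374); 0; 0; 0; (-12806); (-25058); 0; 10375; 0; 0; 0; 7203],
     (1211760, (-2423520), 0))%BZ;
  ([:: 0; (-12200); 0; 0; (-87516); 46318; (-46118); 0; 0; 0; 0; (-53798); 45125; 0; 0],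
     (2423520, 0, 2423520))%BZ;
  ([:: 0; 4408; 0; 0; 6732; (-1142); 334; 0; 0; 0; 0; 2638; (-2785); 0; 0],
     (80784, 0, (-323136)))%BZ;
  ([:: 0; 27220; 0; 0; (-26928); 634; 3886; 0; 0; 0; 0; (-8114); 10025; 0; 0],
     (807840, 0, (-1615680)))%BZ;
  ([:: (-495590); 0; 20806; 19054; 0; 0; 0; (-5354); (-4862); 0; (-7175); 0; 0; 0; 4557],
     (403920, (-2423520), 0))%BZ;
  ([:: (-368180); 0; 48316; (-4196); 0; 0; 0; (-27524); (-2057); 0; (-10250); 0; 0; 0;
    10437],
     (605880, (-4847040), 0))%BZ;
  ([:: 391078; 0; (-3782); (-32414); 0; 0; 0; 5818; (-4862); 0; 8955; 0; 0; 0; (-2597)],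
     (161568, 2908224, 0))%BZ;
  ([:: (-125370); 0; (-1398); 8562; 0; 0; 0; 138; 1122; 0; (-1073); 0; 0; 0; (-49)],
     (80784, 0, 0))%BZ;
  ([:: 0; 52820; 0; 0; (-26928); 7034; (-13234); 0; 0; 0; 0; 446; 3625; 0; 0],
     (403920, 0, (-1615680)))%BZ;
  ([:: 0; (-2440); 0; 0; 6732; (-2854); 2894; 0; 0; 0; 0; 1358; (-1073); 0; 0],
     (80784, 0, 0))%BZ;
  ([:: 0; (-116965); 0; 0; (-18513); 10169; 7061; 0; 0; 0; 0; (-8299); 6100; 0; 0],
     (605880, 0, 4847040))%BZ;
  ([:: 129850; 0; (-16058); 8638; 0; 0; 0; 4102; 5236; 0; (-175); 0; 0; 0; (-1321)],
     (201960, 0, 0))%BZ].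
Definition cert_row k := nth ([::], (1, 0, 0))%BZ central_cert k.
Definition zdelta i j : Z := if eqn i j then 1%BZ else 0%BZ.
Definition class_const_sq : seq (seq Z) := Eval vm_compute in
  [seq [seq (zsum [seq Z.of_nat (class_const j q) * Z.of_nat (class_const q l)
                     | q <- iota 0 15] - 9 * zdelta j l)%BZ
          | l <- iota 0 15] | j <- iota 0 15].
Definition central_check :=
  all (fun k => let: (b, (d, mu, nu)) := cert_row k in ~~ Z.eqb d 0 &&
    all (fun l => Z.eqb
      (zsum [seq nth 0 b j * nth 0 (nth [::] class_const_sq j) l | j <- iota 0 15])
      (d * zdelta k l - mu * zdelta 0 l - nu * zdelta 1 l))%BZ (iota 0 15))
    (iota 0 15).

(** Points where both merging modules have a nonzero value, and points such that
    the sums of the two modules over their orbits under the stabilizers of the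
    former are not proportional to these values. *)
Definition pair_pt s : code :=
  nth [::] [:: [:: 0; 2; 4; 5; 3; 6; 1]; [:: 1; 2; 3; 4; 5; 6; 0]] s.
Definition pair_other r s : code := nth [::] (nth [::]
  [:: [:: [:: 0; 2; 3; 4; 5; 6; 1]; [:: 0; 2; 3; 4; 6; 1; 5]];
      [:: [:: 1; 2; 3; 4; 5; 6; 0]; [:: 1; 2; 3; 4; 6; 0; 5]]] r) s.
Definition stab_conj k r p w : Z :=
  zsum [seq module_val k r (codeJ w g) | g <- codes & code_eq (codeJ p g) p].
Definition stab_rev k r p w : Z :=
  zsum [seq module_val k r (codeV (codeJ w g))
          | g <- codes & code_eq (codeV (codeJ p g)) p].
Definition stab_sum k r p w : Z := (stab_conj k r p w + stab_rev k r p w)%BZ.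
Definition pair_check :=
  all (fun s => [&& is_code (pair_pt s),
      ~~ Z.eqb (module_val 6 s (pair_pt s)) 0 &
      ~~ Z.eqb (module_val 24 s (pair_pt s)) 0]) [:: 0; 1] &&
  all (fun r => all (fun s => [&& is_code (pair_other r s),
      eqn (class_no (pair_other r s)) (row_no (nth_module 6) r) &
      ~~ Z.eqb (module_val 24 s (pair_pt s) *
                  stab_sum 6 r (pair_pt s) (pair_other r s))
               (module_val 6 s (pair_pt s) *
                  stab_sum 24 r (pair_pt s) (pair_other r s))]) [:: 0; 1]) [:: 0; 1].

(** * Words represent permutations *)

Lemma code_eqP u v : reflect (u = v) (code_eq u v).
Proof.
apply: (iffP idP) => [|<-].
  elim: u v => [|a u IHu] [|b v] //=; case: ifP => // /eqP -> /IHu -> //.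
by elim: u => //= a u ->; rewrite (eqxx a : eqn a a).
Qed.

Lemma codesE : codes = permutations code1.
Proof. by vm_compute. Qed.

Definition code_of (s : {perm 'I_7}) : code := [seq val (s i) | i <- enum 'I_7].

Lemma nth_code s (i : 'I_7) : nth 0 (code_of s) i = s i.
Proof. by rewrite (nth_map i) ?size_enum_ord // nth_ord_enum. Qed.

Lemma code_of_inj : injective code_of.
Proof.
by move=> s t st; apply/permP => i; apply: val_inj; rewrite /= -!nth_code st.
Qed.

Lemma code_of1 : code_of 1%g = code1.
Proof.
rewrite /code1 -val_enum_ord; apply: eq_map => i; exact: congr1 (perm1 i).
Qed.

Lemma code_ofM s t : code_of (s * t)%g = codeM (code_of s) (code_of t).
Proof. by rewrite /codeM -map_comp; apply: eq_map => i; rewrite /= permM nth_code. Qed.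

Lemma code_ofV s : code_of s^-1%g = codeV (code_of s).
Proof.
rewrite /codeV /code1 -val_enum_ord -map_comp; apply: eq_map => i /=.
rewrite -{2}(permKV s i) (index_map (f := fun j => val (s j))) ?index_enum_ord //.
by move=> j k /val_inj/perm_inj.
Qed.

Lemma code_ofJ s t : code_of (s ^ t)%g = codeJ (code_of s) (code_of t).
Proof. by rewrite conjgE mulgA !code_ofM code_ofV. Qed.

Lemma is_codeP u : reflect (exists s, code_of s = u) (is_code u).
Proof.
apply: (iffP and3P) => [[/eqP sz /allP lt7 uniq_u]|[s <-]]; last first.
  rewrite size_map size_enum_ord map_inj_uniq ?enum_uniq => [|i j /val_inj/perm_inj //].
  by split=> //; apply/allP => _ /mapP[i _ ->]; apply: (valP (s i)).
have lt_nth (i : 'I_7) : nth 0 u i < 7 by apply/lt7/mem_nth; rewrite sz.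
pose f i := Ordinal (lt_nth i).
have f_inj : injective f.
  move=> i j [/eqP]; rewrite nth_uniq ?sz // => /eqP; exact: val_inj.
exists (perm f_inj); apply: (@eq_from_nth _ 0); rewrite size_map size_enum_ord // => i lti.
by rewrite (nth_code _ (Ordinal lti)) permE.
Qed.

Lemma is_code_of s : is_code (code_of s).
Proof. by apply/is_codeP; exists s. Qed.

Lemma code_perm : perm_eq (map code_of (enum {perm 'I_7})) codes.
Proof.
apply: uniq_perm => [||u].
- by rewrite map_inj_uniq ?enum_uniq //; apply: code_of_inj.
- by rewrite codesE permutations_uniq.
rewrite codesE mem_permutations; apply/mapP/idP => [[s _ ->]|up].
  apply: uniq_perm; rewrite ?iota_uniq //; first by case/and3P: (is_code_of s).
  case/and3P: (is_code_of s) => /eqP sz /allP lt7 us.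
  have sub7 : {subset code_of s <= iota 0 7} by move=> a /lt7; rewrite mem_iota.
  by have [|_] := uniq_min_size us sub7; rewrite ?sz.
have /is_codeP[s <-] : is_code u; last by exists s; rewrite ?mem_enum.
rewrite /is_code (perm_size up) (perm_uniq up) iota_uniq andbT.
by apply/allP => a; rewrite (perm_mem up) mem_iota.
Qed.

Lemma all_codes (p : pred code) : all p codes -> forall s, p (code_of s).
Proof.
move=> /allP pP s; apply: pP; rewrite -(perm_mem code_perm).
by apply: map_f; rewrite mem_enum.
Qed.

Lemma has_codes (p : pred code) : has p codes -> exists s, p (code_of s).
Proof.
case/hasP => u; rewrite -(perm_mem code_perm) => /mapP[s _ ->] pu.
by exists s.
Qed.

Lemma big_codes (R : Type) (idx : R) (op : Monoid.com_law idx) (p : pred code) (f : code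
  -> R) :
  \big[op/idx]_(u <- codes | p u) f u = \big[op/idx]_(s | p (code_of s)) f (code_of s).
Proof. by rewrite -(perm_big _ code_perm) big_map big_enum_cond. Qed.

Lemma count_codes (p : pred code) : count p codes = #|[set s | p (code_of s)]|.
Proof. by rewrite -sum1_count big_codes -sum1_card; apply: eq_bigl => s; rewrite inE. Qed.

(** * Results of the checks *)

Lemma class_checked : all class_check codes.
Proof. by vm_cast_no_check (erefl true). Qed.
Lemma rep_checked : all rep_check (iota 0 15).
Proof. by vm_cast_no_check (erefl true). Qed.
Lemma stable_checked : all stable_check codes.
Proof. by vm_cast_no_check (erefl true). Qed.
Lemma class_const_checked : all class_const_check codes.
Proof. by vm_cast_no_check (erefl true). Qed.
Lemma burnside_checked : burnside_sum = burnside_total.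
Proof. by vm_cast_no_check (erefl burnside_total). Qed.
Lemma seed_checked : all seed_check (iota 0 24).
Proof. by vm_cast_no_check (erefl true). Qed.
Lemma tree_checked : all tree_check (iota 0 24).
Proof. by vm_cast_no_check (erefl true). Qed.
Lemma pivot_checked : all pivot_check (iota 0 24).
Proof. by vm_cast_no_check (erefl true). Qed.
Lemma num_rows_checked : num_rows_check.
Proof. by vm_cast_no_check (erefl true). Qed.
Lemma row_no_checked : row_no_check.
Proof. by vm_cast_no_check (erefl true). Qed.
Lemma separation_checked : separation_check.
Proof. by vm_cast_no_check (erefl true). Qed.
Lemma central_checked : central_check.
Proof. by vm_cast_no_check (erefl true). Qed.
Lemma pair_checked : pair_check.
Proof. by vm_cast_no_check (erefl true). Qed.

Lemma all_iotaP (p : pred nat) n : all p (iota 0 n) -> forall i, i < n -> p i.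
Proof. by move=> /allP pP i lti; apply: pP; rewrite mem_iota. Qed.

Local Notation gT := {perm 'I_7}.

Lemma class_no_lt (x : gT) : class_no (code_of x) < 15.
Proof. by have /and4P[] := all_codes class_checked x. Qed.

Definition perm_class (x : gT) : 'I_15 := inord (class_no (code_of x)).

Lemma perm_classE x : perm_class x = class_no (code_of x) :> nat.
Proof. by rewrite inordK ?class_no_lt. Qed.

Lemma perm_class_eq x (i : 'I_15) : (perm_class x == i) = eqn (class_no (code_of x)) i.
Proof. by rewrite -val_eqE /= perm_classE. Qed.

Lemma exists_rep (i : 'I_15) : exists2 r : gT, code_of r = class_rep i &
  forall h, perm_class (r ^ h)%g = i.
Proof.
have /andP[/is_codeP[r r_i] /all_codes rP] := all_iotaP rep_checked (ltn_ord i).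
exists r => // h; apply/eqP; rewrite perm_class_eq code_ofJ r_i; exact: rP.
Qed.

Lemma rep_conj (x r : gT) : code_of r = class_rep (class_no (code_of x)) ->
  exists h, x = (r ^ h)%g.
Proof.
move=> r_x; have /and4P[_ /is_codeP[h h_x] /code_eqP e _] := all_codes class_checked x.
exists h; rewrite -h_x -r_x -!code_ofM in e.
by rewrite conjgE -(code_of_inj e) mulKg.
Qed.

(** Both permutations are conjugate to the representative of their class. *)
Lemma perm_class_conj x y : (perm_class x == perm_class y) = (x \in (y ^: [set: gT])%g).
Proof.
have [r r_y rJ] := exists_rep (perm_class y).
have [k yE] : exists h, y = (r ^ h)%g by apply: rep_conj; rewrite r_y perm_classE.
apply/eqP/imsetP => [xy|[h _ ->]]; last by rewrite [in LHS]yE -conjgM rJ.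
have [h ->] : exists h, x = (r ^ h)%g by apply: rep_conj; rewrite r_y -xy perm_classE.
by exists (k^-1 * h)%g; rewrite ?inE // yE -conjgM mulKVg.
Qed.

Lemma perm_class_onto i : exists x, perm_class x = i.
Proof. by have [r _ /(_ 1%g)] := exists_rep i; exists (r ^ 1)%g. Qed.

Lemma perm_class_inv x : perm_class x^-1%g = perm_class x.
Proof.
apply/eqP; rewrite perm_class_eq code_ofV perm_classE.
by have /and4P[] := all_codes class_checked x.
Qed.

Lemma transpositionsE : transpositions = [seq u <- codes | eqn (class_no u) 1].
Proof. by vm_compute. Qed.
(* Unification must not unfold the large literals. *)
Opaque module_table codes transpositions block_table.

(** * Counting the orbits on pairs *)

Lemma num_commutingJ (rT : finGroupType) (g h : rT) : num_commuting (g ^ h)%g =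
  num_commuting g.
Proof.
rewrite /num_commuting -[RHS](card_imset _ (conjg_inj h)); apply: eq_card => x; rewrite inE.
apply/eqP/imsetP => [fix_x|[y]]; last by rewrite inE => /eqP e ->; rewrite -!conjMg e.
have [y def_x] : exists y : rT, x = (y ^ h)%g :> rT by exists ((x : rT) ^ h^-1)%g;
  rewrite conjgKV.
by exists y => //; rewrite inE; apply/eqP/(conjg_inj h); rewrite !conjMg -def_x.
Qed.

Lemma num_invertingJ (rT : finGroupType) (g h : rT) : num_inverting (g ^ h)%g =
  num_inverting g.
Proof.
rewrite /num_inverting -[RHS](card_imset _ (conjg_inj h)); apply: eq_card => x; rewrite inE.
apply/eqP/imsetP => [fix_x|[y]]; last by rewrite inE => /eqP e ->; rewrite -!conjMg e.
have [y def_x] : exists y : rT, x = (y ^ h)%g :> rT by exists ((x : rT) ^ h^-1)%g;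
  rewrite conjgKV.
by exists y => //; rewrite inE; apply/eqP/(conjg_inj h); rewrite !conjMg -def_x.
Qed.

Lemma num_commuting_code (g : gT) : num_commuting g = code_commuting (code_of g).
Proof.
rewrite /code_commuting count_codes; apply: eq_card => x; rewrite !inE -!code_ofM.
by apply/eqP/code_eqP => [->|/code_of_inj].
Qed.

Lemma num_inverting_code (g : gT) : num_inverting g = code_inverting (code_of g).
Proof.
rewrite /code_inverting count_codes; apply: eq_card => x; rewrite !inE -!code_ofM.
by apply/eqP/code_eqP => [->|/code_of_inj].
Qed.

Lemma Z_of_natD a b : Z.of_nat (a + b) = (Z.of_nat a + Z.of_nat b)%BZ.
Proof. exact: Nat2Z.inj_add. Qed.

Lemma Z_of_natM a b : Z.of_nat (a * b) = (Z.of_nat a * Z.of_nat b)%BZ.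
Proof. exact: Nat2Z.inj_mul. Qed.

Lemma zsum_of_nat (T : Type) (s : seq T) (f : T -> nat) :
  Z.of_nat (\sum_(i <- s) f i) = zsum [seq Z.of_nat (f i) | i <- s].
Proof.
elim: s => [|i s IHs]; first by rewrite big_nil.
by rewrite big_cons /= -IHs -Z_of_natD.
Qed.

Lemma card_perm7 : Z.of_nat #|gT| = order7.
Proof.
have := perm_size code_perm; rewrite size_map -cardE => ->.
by vm_compute.
Qed.

Lemma card_orbits7 : #|pair_orbits gT| = 4043.
Proof.
have key a b : Z.of_nat b = order7 -> a * (b * 2) = \sum_(i <- iota 0 15)
    count (fun u => eqn (class_no u) i) codes *
      (code_commuting (class_rep i) * code_commuting (class_rep i) + code_inverting
        (class_rep i) * code_inverting (class_rep i)) -> a = 4043.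
  move=> order_b /(congr1 Z.of_nat); rewrite zsum_of_nat.
  rewrite (_ : zsum _ = burnside_total); last first.
    rewrite (eq_map (g := burnside_term)); first exact: burnside_checked.
    by move=> i; rewrite /burnside_term Z_of_natM Z_of_natD !Z_of_natM.
  rewrite 2!Z_of_natM order_b.
  have -> : burnside_total = (burnside_orbits * (order7 * Z.of_nat 2))%BZ by vm_compute.
  move/Z.mul_reg_r => /(_ ltac:(done)).
  have -> : burnside_orbits = Z.of_nat 4043 by vm_compute.
  exact: Nat2Z.inj.
apply: key card_perm7 _; rewrite card_pair_orbits (partition_big perm_class xpredT) //.
rewrite -[iota 0 15]/(index_iota 0 15) big_mkord; apply: eq_bigr => i _.
rewrite count_codes -sum_nat_const.
apply: eq_big => [g|g /eqP g_i]; first by rewrite inE perm_class_eq.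
have [r r_i rJ] := exists_rep i.
have [h ->] : exists h, g = (r ^ h)%g by apply: rep_conj; rewrite r_i -g_i perm_classE.
by rewrite num_commutingJ num_invertingJ num_commuting_code num_inverting_code r_i -!mulnn.
Qed.

Local Open Scope ring_scope.

(** * The table describes modules over the Terwilliger algebra *)

Lemma zsumE (T : Type) (s : seq T) (f : T -> Z) : zsum [seq f i | i <- s] = \sum_(i <- s)
  f i.
Proof. by elim: s => [|i s IHs]; rewrite ?big_nil // big_cons /= IHs. Qed.

Definition mat_coef (v : seq (seq Z)) k a : Z := nth 0 (nth [::] v k) a.

Lemma nth_zadd_seq u v a : nth 0 (zadd_seq u v) a = nth 0 u a + nth 0 v a :> Z.
Proof.
elim: u v a => [|x u IHu] [|y v] a; rewrite ?nth_nil ?add0r ?addr0 //=.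
by case: a => [|a] //=.
Qed.

Lemma coef_zadd_mat u v k a : mat_coef (zadd_mat u v) k a = mat_coef u k a + mat_coef v k a.
Proof.
rewrite /mat_coef; elim: u v k => [|x u IHu] [|y v] k;
  rewrite /= ?nth_nil ?add0r ?addr0 //=.
by case: k => [|k] /=; rewrite ?nth_zadd_seq ?IHu.
Qed.

Lemma coef_foldr vs k a : mat_coef (foldr zadd_mat [::] vs) k a = \sum_(v <- vs) mat_coef
  v k a.
Proof.
elim: vs => [|v vs IHv]; first by rewrite big_nil /mat_coef !nth_nil.
by rewrite big_cons /= coef_zadd_mat IHv.
Qed.

Lemma zeq_seqP u v : zeq_seq u v -> u = v.
Proof.
elim: u v => [|x u IHu] [|y v] //=.
by case: ifP => // /Z.eqb_spec -> /IHu ->.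
Qed.

Lemma zeq_matP u v : zeq_mat u v -> u = v.
Proof.
elim: u v => [|x u IHu] [|y v] //=.
by case: ifP => // /zeq_seqP -> /IHu ->.
Qed.

Lemma coef_act_blocks B v k a :
  mat_coef (act_blocks B v) k a = zdot (nth [::] (nth [::] B k) a) (nth [::] v k).
Proof.
rewrite /mat_coef; elim: B v k => [|b B IHB] [|x v] k; rewrite /= ?nth_nil //=.
- by case: (nth _ _ _).
case: k => [|k] //=.
have [lt_a|le_a] := ltnP a (size b); first by rewrite (nth_map [::]).
by rewrite !nth_default ?size_map.
Qed.

Lemma zdotE u v n : (size u <= n)%N -> zdot u v = \sum_(b <- iota 0 n) nth 0 u b * nth 0 v
  b.
Proof.
elim: u v n => [|x u IHu] v n; first by rewrite /= big1 // => b _; rewrite nth_nil mul0r.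
case: n => // n; case: v => [|y v] /= le_un.
  by rewrite big1 // => b _; rewrite nth_nil mulr0.
rewrite big_cons /= (IHu _ n) // -[1%N]addn0 iotaDl big_map; congr (_ + _).
Qed.

Lemma nth_blocks i j k a b : nth 0 (nth [::] (nth [::] (blocks i j) k) a) b =
  nth 0 (nth [::] (nth [::] [seq [seq [seq act_entry d r s | s <- class_rows d j] | r <-
    class_rows d i]
    | d <- modules] k) a) b.
Proof.
rewrite /blocks; set B := map _ modules; case: ifP => // /allP B0; rewrite !nth_nil.
have [lt_k|/(nth_default [::]) ->] := ltnP k (size B); last by rewrite !nth_nil.
have /allP Bk := B0 _ (mem_nth [::] lt_k).
have [lt_a|/(nth_default [::]) ->] := ltnP a (size (nth [::] B k));
  last by rewrite !nth_nil.
have /allP Ba := Bk _ (mem_nth [::] lt_a).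
have [lt_b|/(nth_default 0) ->//] := ltnP b (size (nth [::] (nth [::] B k) a)).
by have /Z.eqb_spec := Ba _ (mem_nth 0 lt_b).
Qed.

Lemma block_table_def :
  block_table = [seq [seq blocks i j | i <- iota 0 15] | j <- iota 0 15].
Proof. by vm_compute. Qed.

Lemma size_block_table j : (j < 15)%N -> size (nth [::] block_table j) = 15.
Proof. by move=> ltj; rewrite block_table_def (nth_map 0%N) ?size_iota // size_map
  size_iota. Qed.

Lemma block_tableE i j : (i < 15)%N -> (j < 15)%N ->
  nth [::] (nth [::] block_table j) i = blocks i j.
Proof.
by move=> lti ltj; rewrite block_table_def !(nth_map 0%N) ?size_map ?size_iota // !nth_iota.
Qed.

Lemma row_no_lt k r : (row_no (nth_module k) r < 15)%N.
Proof.
rewrite /row_no /nth_module; set d0 := ModuleData _ _ _ _ _ _.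
have [lt_k|le_k] := ltnP k (size modules); last by rewrite (nth_default d0 le_k) nth_nil.
have d15 : all (fun c => c < 15)%N (row_class (nth d0 modules k)).
  by have := row_no_checked; rewrite /row_no_check => /(all_nthP d0)/(_ k lt_k).
have [lt_r|le_r] := ltnP r (size (row_class (nth d0 modules k))).
  exact: (allP d15 _ (mem_nth 0%N lt_r)).
by rewrite nth_default.
Qed.

Lemma mem_class_rows d i r : (r \in class_rows d i) = (row_no d r == i) &&
  (r < num_rows d)%N.
Proof. by rewrite mem_filter mem_iota. Qed.

Lemma class_rows_uniq d i : uniq (class_rows d i).
Proof. by rewrite filter_uniq ?iota_uniq. Qed.

Lemma nth_blocks_row i j k r b : (k < 25)%N -> (r \in class_rows (nth_module k) i) ->
  nth 0 (nth [::] (nth [::] (blocks i j) k) (index r (class_rows (nth_module k) i))) b =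
  nth 0 [seq act_entry (nth_module k) r s | s <- class_rows (nth_module k) j] b.
Proof.
move=> lt_k r_i; rewrite nth_blocks (nth_map (ModuleData [::] false [::] 0%BZ [::] [::]))
  //.
by rewrite (nth_map 0%N) ?index_mem // nth_index.
Qed.

Lemma size_blocks_row i j k a : (k < 25)%N ->
  (size (nth [::] (nth [::] (blocks i j) k) a) <= size (class_rows (nth_module k) j))%N.
Proof.
move=> lt_k; rewrite /blocks; case: ifP => _; rewrite ?nth_nil //.
rewrite (nth_map (ModuleData [::] false [::] 0%BZ [::] [::])) //.
set rs := class_rows _ i; have [lt_a|le_a] := ltnP a (size rs).
  by rewrite (nth_map 0%N) // size_map.
by rewrite nth_default ?size_map.
Qed.

Lemma module_val_out k r u : class_no u != row_no (nth_module k) r -> module_val k r u = 0.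
Proof. by rewrite /module_val -/(class_no u) => /negPf; rewrite -eqE /= => ->. Qed.

(** The entry (r, x) of P A = M P. *)
Lemma module_val_adj k r (x : gT) : (k < 25)%N -> (r < num_rows (nth_module k))%N ->
  \sum_(t | perm_class t == inord 1) module_val k r (code_of (x * t)%g) =
  \sum_(s <- iota 0 (num_rows (nth_module k))) act_entry (nth_module k) r s * module_val k
    s (code_of x).
Proof.
set d := nth_module k => lt_k lt_r; pose i := row_no d r; pose u := code_of x.
have lt_i : (i < 15)%N by apply: row_no_lt.
have lt_j : (class_no u < 15)%N by apply: class_no_lt.
have mem_i : (i, blocks i (class_no u)) \in zip (iota 0 15) (nth [::] block_table
  (class_no u)).
  rewrite -(block_tableE lt_i lt_j).
  have <- : nth (0%N, [::]) (zip (iota 0 15) (nth [::] block_table (class_no u))) i =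
      (i, nth [::] (nth [::] block_table (class_no u)) i).
    by rewrite nth_zip ?size_block_table ?size_iota // (nth_iota 0 0 lt_i).
  by apply: mem_nth; rewrite size_zip size_iota size_block_table.
have /allP/(_ _ mem_i)/zeq_matP/(congr1 (fun v => mat_coef v k (index r (class_rows d
  i)))) :=
  all_codes stable_checked x.
rewrite coef_foldr big_map big_filter big_map coef_act_blocks transpositionsE.
rewrite big_filter_cond big_codes /= => e.
transitivity (\sum_(t : gT | eqn (class_no (code_of t)) 1 &&
  eqn (class_no (code_of (x * t)%g)) i)
    mat_coef (table_row (code_of (x * t)%g)).2 k (index r (class_rows d i))).
  rewrite big_mkcondr; apply: eq_big => [t|t _]; first by rewrite perm_class_eq inordK.
  rewrite /module_val -/d -/(class_no _) -/i; case: ifP => [/eqP ->|] //.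
transitivity (\sum_(t : gT | eqn (class_no (code_of t)) 1 &&
  eqn (class_no (codeM u (code_of t))) i)
    mat_coef (table_row (codeM u (code_of t))).2 k (index r (class_rows d i))).
  by apply: eq_big => t; rewrite ?code_ofM // => _; rewrite code_ofM.
rewrite e (zdotE _ (size_blocks_row _ _ _ lt_k)).
transitivity (\sum_(s <- class_rows d (class_no u)) act_entry d r s * module_val k s u).
  rewrite [RHS](big_nth 0%N) /index_iota subn0 !big_seq; apply: eq_bigr => b.
  rewrite mem_iota /= add0n => lt_b.
  rewrite nth_blocks_row ?mem_class_rows ?eqxx // (nth_map 0%N) //; congr (_ * _).
  have := mem_nth 0%N lt_b; rewrite mem_class_rows => /andP[/eqP rcls_b _].
  by rewrite /module_val -/d -/(class_no u) rcls_b (eqxx _ : eqn _ _) index_uniq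
    ?class_rows_uniq.
rewrite big_filter [LHS]big_mkcond; apply: eq_bigr => s _.
case: ifP => // /negbT ne; rewrite module_val_out ?mulr0 // eq_sym; exact: ne.
Qed.

Lemma big_iota (V : nmodType) n (p : pred nat) (f : nat -> V) :
  \sum_(i <- iota 0 n | p i) f i = \sum_(i < n | p i) f i.
Proof. by rewrite -(big_mkord p f) /index_iota subn0. Qed.

Section Modules.

Variable F : numClosedFieldType.
Local Notation N := #|gT|.-1.

Definition of_Z : Z -> F := intr \o int_of_Z.
HB.instance Definition _ := GRing.RMorphism.copy of_Z (intr \o int_of_Z).

Lemma of_Z_eq0 z : (of_Z z == 0) = (z == 0).
Proof. by rewrite /of_Z /= intr_eq0 -(inj_eq (can_inj int_of_ZK)). Qed.

Lemma of_Z_eq z1 z2 : (of_Z z1 == of_Z z2) = (z1 == z2).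
Proof. by rewrite -subr_eq0 -rmorphB of_Z_eq0 subr_eq0. Qed.

Lemma of_Z_real z : of_Z z \is Num.real.
Proof. exact: realz. Qed.

Local Notation adj := (adj F perm_class).
Local Notation dual := (dual F perm_class).

Definition module_fun k (r : nat) (x : gT) : F := of_Z (module_val k r (code_of x)).
Definition module_rows k n : 'M[F]_(n, N.+1) := fun_mx (fun r : 'I_n => module_fun k r).
Definition module_act k n : 'M[F]_n := \matrix_(r, s) of_Z (act_entry (nth_module k) r s).
Definition module_class k n (r : 'I_n) : 'I_15 := inord (row_no (nth_module k) r).

Lemma module_classE k n (r : 'I_n) : module_class k r = row_no (nth_module k) r :> nat.
Proof. by rewrite inordK ?row_no_lt. Qed.

Lemma module_fun_out k n (r : 'I_n) x : perm_class x != module_class k r ->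
  module_fun k r x = 0.
Proof.
rewrite -val_eqE /= perm_classE module_classE => ne.
by rewrite /module_fun module_val_out ?rmorph0.
Qed.

Lemma module_rows_adj k n : (k < 25)%N -> num_rows (nth_module k) = n ->
  module_rows k n *m adj (inord 1) = module_act k n *m module_rows k n.
Proof.
move=> lt_k dims_k; rewrite /module_rows (fun_mx_adj perm_class_inv); apply/matrixP => r a.
rewrite !mxE -rmorph_sum module_val_adj ?dims_k // rmorph_sum.
rewrite big_iota.
by apply: eq_bigr => s _; rewrite rmorphM !mxE.
Qed.

Lemma module_rows_dual k n i :
  module_rows k n *m dual i =
  diag_mx (\row_r (module_class k r == i)%:R) *m module_rows k n.
Proof.
rewrite /module_rows fun_mx_dual mul_diag_mx; apply/matrixP => r a; rewrite !mxE.
have [->|ne] := eqVneq (perm_class (elt_of a)) (module_class k r); first by rewrite mulrC.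
by rewrite (module_fun_out ne) mul0r mulr0.
Qed.

Lemma module_rows_free k n : (k < 24)%N -> num_rows (nth_module k) = n ->
  row_free (module_rows k n).
Proof.
move=> lt_k dims_k.
have piv (r : 'I_n) : exists x : gT, module_val k r (code_of x) != 0 /\
    forall q : 'I_n, (r < q)%N -> module_val k q (code_of x) = 0.
  have := all_iotaP pivot_checked lt_k; rewrite /pivot_check dims_k.
  move=> /all_iotaP/(_ r (ltn_ord r))/has_codes[x].
  case: ifP => // /Z.eqb_spec/eqP nz later; exists x; split=> // q lt_rq.
  have [rcls_x|] := eqVneq (class_no (code_of x)) (row_no (nth_module k) r);
    last by move/module_val_out/eqP; rewrite (negPf nz).
  have [rcls_q|] := eqVneq (class_no (code_of x)) (row_no (nth_module k) q);
    last exact: module_val_out.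
  apply/Z.eqb_spec; apply: (allP later); rewrite mem_filter lt_rq mem_class_rows.
  by rewrite -rcls_q rcls_x eqxx dims_k ltn_ord.
have [p pP] := fin_all_exists piv.
apply: (@row_free_pivots _ _ _ _ (fun r => idx_of (p r))) => [r|r q lt_rq].
  by rewrite mxE /module_fun idx_ofK of_Z_eq0; case: (pP r).
by rewrite mxE /module_fun idx_ofK (pP r).2 ?rmorph0.
Qed.

Definition block_dim (k : 'I_24) := nth 0%N block_dims k.
Local Notation P k := (module_rows k (block_dim k).+1).
Local Notation M k := (module_act k (block_dim k).+1).

Lemma num_rows_block (k : 'I_24) : num_rows (nth_module k) = (block_dim k).+1.
Proof.
have /code_eqP e := num_rows_checked.
have lt_k : (k < size block_dims)%N := ltn_ord k.
rewrite -[LHS](nth_map _ 0%N num_rows (s := modules)) ?(leq_trans (ltn_ord k)) // e.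
by rewrite nth_rcons size_map lt_k (nth_map 0%N).
Qed.

Lemma gram_block (k : 'I_24) : P k *m (P k)^T \in unitmx.
Proof.
apply: gram_unitmx => [i j|]; first by rewrite mxE of_Z_real.
by apply: module_rows_free; rewrite ?num_rows_block.
Qed.

Lemma block_seed_alone (k : 'I_24) (r : 'I_(block_dim k).+1) :
  module_class k r = module_class k (0 : 'I_(block_dim k).+1) -> r = 0.
Proof.
move/(congr1 val); rewrite /= !module_classE => r0.
have /code_eqP := all_iotaP seed_checked (ltn_ord k).
move/(congr1 (fun s => val r \in s)); rewrite mem_class_rows num_rows_block ltn_ord r0
  eqxx inE.
by move/esym/eqP => e; apply: val_inj.
Qed.

Lemma block_tree (k : 'I_24) (r : 'I_(block_dim k).+1) : r != 0 ->
  exists s : 'I_(block_dim k).+1, [/\ (s < r)%N, M k s r != 0 &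
    forall q : 'I_(block_dim k).+1, (r < q)%N -> module_class k q = module_class k r ->
      M k s q = 0].
Proof.
move=> r0; have := all_iotaP tree_checked (ltn_ord k).
rewrite /tree_check num_rows_block /= => /allP/(_ (val r)).
rewrite mem_iota add1n ltn_ord andbT lt0n => /(_ r0)/hasP[s];
  rewrite mem_iota /= add0n => lt_sr.
case: ifP => // /Z.eqb_spec/eqP nz later.
exists (Ordinal (ltn_trans lt_sr (ltn_ord r))); split=> //; first by rewrite mxE of_Z_eq0.
move=> q lt_rq /(congr1 val); rewrite /= !module_classE => qr; rewrite mxE /=.
have := allP later (val q); rewrite mem_class_rows qr eqxx num_rows_block ltn_ord leqNgt
  lt_rq.
by move=> /(_ isT)/Z.eqb_spec ->; rewrite rmorph0.
Qed.

Lemma return_weightE (k : 'I_24) (r : 'I_(block_dim k).+1) (j : 'I_15) :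
  return_weight (fun k : 'I_24 => M k) (fun (k : 'I_24) r => module_class k r) r j =
  of_Z (weight k r j).
Proof.
rewrite /return_weight /weight zsumE big_filter num_rows_block.
rewrite big_iota rmorph_sum /=.
apply: eq_big => [q|q _]; first by rewrite -val_eqE /= module_classE.
by rewrite !mxE rmorphM.
Qed.

Definition block_order : seq 'I_24 := [seq inord k | k <- separation_order].

Lemma val_block_order : map val block_order = separation_order.
Proof.
rewrite -map_comp map_id_in // => k k_s; apply: inordK.
by move: k k_s; apply/allP.
Qed.

Lemma block_separated s1 (k : 'I_24) s2 : block_order = s1 ++ k :: s2 ->
  {in s2, forall l : 'I_24, exists (r0 : 'I_(block_dim l).+1) (j : 'I_15),
   (forall r : 'I_(block_dim l).+1, module_class l r = module_class k (0 : 'I_(block_dim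
     k).+1) -> r = r0) /\
   (module_class l r0 = module_class k (0 : 'I_(block_dim k).+1) ->
     return_weight (fun k : 'I_24 => M k) (fun (k : 'I_24) r => module_class k r) (0 :
       'I_(block_dim k).+1) j !=
     return_weight (fun k : 'I_24 => M k) (fun (k : 'I_24) r => module_class k r) r0 j)}.
Proof.
move=> def_s l l_s2.
have : separated k l.
  have /andP[] := separation_checked; rewrite -val_block_order pairwise_map def_s.
  by rewrite pairwise_cat /= => /and4P[_ _ /allP/(_ l l_s2)].
rewrite /separated; set i := row_no _ 0.
have mem_r (r : 'I_(block_dim l).+1) :
    module_class l r = module_class k (0 : 'I_(block_dim k).+1) ->
      val r \in class_rows (nth_module l) i.
  by move/(congr1 val); rewrite /= !module_classE mem_class_rows num_rows_block ltn_ord =>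
    ->; rewrite eqxx.
case def_rows: (class_rows _ _) => [|r1 [|]] //.
  by move=> _; exists 0, 0; split=> [r|] /mem_r; rewrite def_rows.
move=> /Z.eqb_spec/eqP neq.
have lt_r1 : (r1 < (block_dim l).+1)%N.
  by have := mem_head r1 [::]; rewrite -def_rows mem_class_rows num_rows_block => /andP[].
exists (Ordinal lt_r1), (inord (companion i)); split=> [r /mem_r|_].
  by rewrite def_rows inE => /eqP e; apply: val_inj.
rewrite !return_weightE of_Z_eq inordK //.
have : all (fun c => c < 15)%N [seq companion i | i <- iota 0 15] by [].
move/allP; apply; apply: map_f; rewrite mem_iota; exact: row_no_lt.
Qed.

Lemma block_order_all (k : 'I_24) : k \in block_order.
Proof.
have /andP[_ /all_iotaP/(_ k (ltn_ord k))] := separation_checked.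
by rewrite -val_block_order mem_map //; apply: val_inj.
Qed.

Lemma terwilliger_onto_blocks y : exists x,
  realizes (terwilliger F gT) (fun k : 'I_24 => P k) x y.
Proof.
move: y; apply: (@blocks_onto F N (terwilliger F gT) 'I_15 'I_24 (adj (inord 1)) dual
  block_dim (fun k => P k) (fun k => M k) (fun k r => module_class k r) _ _ _ _ _ _ _ _ _
    _ block_order).
- exact: terwilliger1.
- exact: adj_mem perm_class_conj perm_class_onto _.
- by move=> i; apply: dual_mem perm_class_conj perm_class_onto _.
- exact: adj_sym perm_class_inv _.
- by move=> i; apply: dual_sym.
- by move=> k; apply: module_rows_adj; rewrite ?num_rows_block // (ltn_trans (ltn_ord k)).
- by move=> k i; apply: module_rows_dual.
- exact: gram_block.
- exact: block_seed_alone.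
- exact: block_tree.
- exact: block_order_all.
- exact: block_separated.
Qed.

End Modules.

(** * The dimension bound for Sym(7) *)

Lemma class_constE (z : gT) (j : 'I_15) :
  #|[set t | (perm_class t == inord 1) && (perm_class (t * z)%g == j)]| = class_const j
    (perm_class z).
Proof.
have /code_eqP/(congr1 (fun s => nth 0%N s j)) := all_codes class_const_checked z.
rewrite (nth_map 0%N) ?size_iota // nth_iota // add0n count_map transpositionsE
  count_filter.
rewrite count_codes /class_const perm_classE => <-; apply: eq_card => t.
by rewrite !inE !perm_class_eq inordK //= code_ofM andbC.
Qed.

Lemma class_const_sqE j l : (j < 15)%N -> (l < 15)%N ->
  nth 0 (nth [::] class_const_sq j) l =
  \sum_(q < 15) Z.of_nat (class_const j q) * Z.of_nat (class_const q l) - 9%BZ * zdelta j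
    l :> Z.
Proof.
have -> : class_const_sq = [seq [seq (zsum [seq Z.of_nat (class_const j q) * Z.of_nat
  (class_const q l) | q <- iota 0 15] - 9 * zdelta j l)%BZ
    | l <- iota 0 15] | j <- iota 0 15] by vm_compute.
move=> ltj ltl; rewrite (nth_map 0%N) ?size_iota // (nth_map 0%N) ?size_iota // !nth_iota
  //.
by rewrite zsumE big_iota.
Qed.

Section Dimension.

Variable F : numClosedFieldType.
Local Notation N := #|gT|.-1.
Local Notation adj := (adj F perm_class).
Local Notation of_Z := (of_Z F).

Lemma of_Z_nat n : of_Z (Z.of_nat n) = n%:R.
Proof. by rewrite /of_Z /= (Z_of_intK n) pmulrn. Qed.

Lemma of_ZD x y : of_Z (x + y) = of_Z x + of_Z y.
Proof. exact: rmorphD. Qed.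

Lemma of_ZM x y : of_Z (x * y) = of_Z x * of_Z y.
Proof. exact: rmorphM. Qed.

Lemma of_Z_delta n (i j : 'I_n) : of_Z (zdelta i j) = (i == j)%:R.
Proof. by rewrite /zdelta -val_eqE /= -eqE; case: eqP; rewrite ?rmorph0 ?rmorph1. Qed.

Lemma adj_square_act n k :
  exists mu nu : F, forall Q : 'M[F]_(n, N.+1),
   Q *m adj (inord 1) *m adj (inord 1) = 9%:R *: Q ->
   Q *m adj k = mu *: Q + nu *: (Q *m adj (inord 1)).
Proof.
have := all_iotaP central_checked (ltn_ord k).
case def_row: (cert_row k) => [b [[d mu] nu]] /andP[/Z.eqb_spec/eqP d0 cert].
exists (of_Z mu / of_Z d), (of_Z nu / of_Z d) => Q QA.
apply: (@adj_central _ _ _ perm_class n Q (inord 0) (inord 1) (fun j l => (class_const j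
  l)%:R) 9%:R
  (fun j => of_Z (nth 0 b j)) (of_Z d) (of_Z mu) (of_Z nu) k) => //.
- by move=> j; apply: (@adjM F gT _ perm_class perm_class_inv (inord 1) j (fun j l : 'I_15
    => class_const j l)) => z; apply: class_constE.
- apply/matrixP => x y; rewrite adjE mxE -(inj_eq (can_inj (@elt_ofK _))).
  congr (_%:R); congr nat_of_bool.
  have -> : inord 0 = perm_class 1%g.
    by apply/esym/eqP; rewrite perm_class_eq inordK // code_of1; vm_compute.
  by rewrite perm_class_conj class1G inE -eq_mulVg1.
- by rewrite of_Z_eq0.
move=> l; have /Z.eqb_spec := all_iotaP cert (ltn_ord l).
rewrite zsumE big_iota => /(congr1 of_Z).
rewrite !rmorphB !rmorphM rmorph_sum /=.
have inord_val i : (i < 15)%N -> zdelta i l = zdelta (inord i : 'I_15) l.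
  by move=> lt_i; rewrite inordK.
rewrite (inord_val 0%N) // (inord_val 1%N) // !of_Z_delta !mulr_natr => <-.
apply: eq_bigr => j _; rewrite rmorphM class_const_sqE // rmorphB rmorphM rmorph_sum.
have fold_Z z : (of_Z : {rmorphism Z -> F}) z = of_Z z by [].
rewrite !fold_Z of_Z_delta mulr_natr -(of_Z_nat 9); congr (_ * (_ - _)).
by apply: eq_bigr => q _; rewrite rmorphM !fold_Z !of_Z_nat.
Qed.

Local Notation pair_rows k := (module_rows F k 2).

(** The characters (4,3) and (4,1,1,1) merge because A has the same eigenvalues,
    3 and -3, on their multiplicity spaces. *)
Lemma pair_act_sq : module_act F 6 2 *m module_act F 6 2 = 9%:R%:M.
Proof.
apply/matrixP => r s; rewrite !mxE big_ord_recl big_ord1 !mxE.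
rewrite -[_ *+ (r == s)]mulr_natr -of_Z_delta -(of_Z_nat 9) -!of_ZM -of_ZD.
by apply: (congr1 of_Z); case: r s => [[|[|//]] ?] [[|[|//]] ?]; vm_compute.
Qed.

Lemma pair_act_eq : module_act F 24 2 = module_act F 6 2.
Proof.
by apply/matrixP => r s; rewrite !mxE; congr of_Z; case: r s => [[|[|//]] ?] [[|[|//]] ?];
  vm_compute.
Qed.

Lemma pair_same_adj i : exists y,
  pair_rows 6 *m adj i = y *m pair_rows 6 /\ pair_rows 24 *m adj i = y *m pair_rows 24.
Proof.
have [mu [nu act]] := adj_square_act 2 i.
exists (mu%:M + nu *: module_act F 6 2).
have e6 : pair_rows 6 *m adj (inord 1) = module_act F 6 2 *m pair_rows 6.
  by apply: module_rows_adj; vm_compute.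
have e24 : pair_rows 24 *m adj (inord 1) = module_act F 6 2 *m pair_rows 24.
  by rewrite -pair_act_eq; apply: module_rows_adj; vm_compute.
have sq Q : Q *m adj (inord 1) = module_act F 6 2 *m Q ->
    Q *m adj (inord 1) *m adj (inord 1) = 9%:R *: Q.
  by move=> e; rewrite e -mulmxA e mulmxA pair_act_sq mul_scalar_mx.
by rewrite !act ?sq // e6 e24 !mulmxDl !mul_scalar_mx -!scalemxAl.
Qed.

Lemma stab_sumE k r (p w : gT) :
  \sum_(h : gT * 'I_2 | twist p h == p) module_fun F k r (twist w h) =
  of_Z (stab_sum k r (code_of p) (code_of w)).
Proof.
have stab_conjE : stab_conj k r (code_of p) (code_of w) =
    \sum_(g | code_eq (codeJ (code_of p) (code_of g)) (code_of p))
      module_val k r (codeJ (code_of w) (code_of g)).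
  by rewrite /stab_conj zsumE big_filter big_codes.
have stab_revE : stab_rev k r (code_of p) (code_of w) =
    \sum_(g | code_eq (codeV (codeJ (code_of p) (code_of g))) (code_of p))
      module_val k r (codeV (codeJ (code_of w) (code_of g))).
  by rewrite /stab_rev zsumE big_filter big_codes.
rewrite [of_Z _](of_ZD (stab_conj _ _ _ _)) stab_conjE stab_revE.
rewrite /of_Z !rmorph_sum big_mkcond.
rewrite -(pair_bigA _ (fun g i => if twist p (g, i) == p then
  module_fun F k r (twist w (g, i)) else 0)).
under eq_bigr do rewrite big_ord_recl big_ord1.
have tw0 (x g : gT) : twist x (g, ord0) = (x ^ g)%g by [].
have tw1 (x g : gT) : twist x (g, lift ord0 ord0) = (x ^ g)^-1%g by [].
rewrite big_split; congr (_ + _); rewrite -big_mkcond.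
  apply: eq_big => [g|g _]; last by rewrite tw0 /module_fun code_ofJ.
  by rewrite tw0 -code_ofJ; apply/eqP/code_eqP => [->|/code_of_inj].
apply: eq_big => [g|g _]; last by rewrite tw1 /module_fun code_ofV code_ofJ.
by rewrite tw1 -code_ofJ -code_ofV; apply/eqP/code_eqP => [->|/code_of_inj].
Qed.

Lemma dim_terwilliger7 : (\dim (terwilliger F gT) <= #|pair_orbits gT| - 2 * 2)%N.
Proof.
have /andP[/allP pts /allP others] := pair_checked.
have mem2 (s : 'I_2) : val s \in [:: 0%N; 1%N] by case: s => [[|[|//]] lt_s].
have ex_p (s : 'I_2) : exists g : gT, [/\ code_of g = pair_pt s,
    module_val 6 s (pair_pt s) != 0 & module_val 24 s (pair_pt s) != 0].
  have /and3P[/is_codeP[g g_s] n6 n24] := pts _ (mem2 s).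
  by exists g.
have ex_w (r s : 'I_2) : exists g : gT, [/\ code_of g = pair_other r s,
    class_no (pair_other r s) = row_no (nth_module 6) r &
    module_val 24 s (pair_pt s) * stab_sum 6 r (pair_pt s) (pair_other r s) !=
    module_val 6 s (pair_pt s) * stab_sum 24 r (pair_pt s) (pair_other r s)].
  have /and3P[/is_codeP[g g_s] /eqP cl_g neq] := allP (others _ (mem2 r)) _ (mem2 s).
  by exists g.
have [p pP] := fin_all_exists ex_p.
have [w wP] := fin_all_exists (fun r => fin_all_exists (ex_w r)).
have c24 (r : 'I_2) : module_class 24 r = module_class 6 r.
  by apply: val_inj; rewrite /= !module_classE; case: r => [[|[|//]] ?]; vm_compute.
rewrite -(addnK (2 * 2)%N (\dim _)); apply: leq_sub2r.
apply: (@dim_terwilliger_merged F gT _ perm_class perm_class_conj perm_class_inv 2 (fun r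
  => module_fun F 6 r)
  (fun r => module_fun F 24 r) (fun r => module_class 6 r) _ _ _ pair_same_adj p w).
- move=> r s /(congr1 val); rewrite /= !module_classE.
  by case: r s => [[|[|//]] ?] [[|[|//]] ?] e; apply: val_inj; move: e; vm_compute.
- by move=> r x; apply: module_fun_out.
- by move=> r x; rewrite -c24; apply: module_fun_out.
- by move=> r; have [e n6 _] := pP r; rewrite /module_fun of_Z_eq0 e.
- by move=> r; have [e _ n24] := pP r; rewrite /module_fun of_Z_eq0 e.
- by move=> r s; apply: val_inj; rewrite /= perm_classE module_classE;
    have [-> -> _] := wP r s.
move=> r s; have [ep _ _] := pP s; have [ew _ neq] := wP r s.
by rewrite !stab_sumE ep ew /module_fun ep -!of_ZM of_Z_eq.
Qed.

End Dimension.

(** * The Wedderburn decomposition *)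

Section Final.
Variable F : numClosedFieldType.
Local Notation T := (terwilliger F gT).

Lemma sum_block_dims : (\sum_(k < 24) (block_dim k).+1 ^ 2 = 4039)%N.
Proof.
rewrite -(big_mkord xpredT (fun k => ((nth 0%N block_dims k).+1 ^ 2)%N)).
by rewrite unlock; vm_compute.
Qed.

Lemma dim_terwilliger_blocks : (\dim T <= \sum_(k < 24) (block_dim k).+1 ^ 2)%N.
Proof.
rewrite sum_block_dims (leq_trans (dim_terwilliger7 F)) // card_orbits7.
by vm_compute.
Qed.

Lemma module_rows_block_free (k : 'I_24) : row_free (module_rows F k (block_dim k).+1).
Proof. by apply: module_rows_free; rewrite ?num_rows_block. Qed.

Let terwilliger_has1 : 1%:M \in T. Proof. exact: terwilliger1. Qed.

Local Notation rows_free := module_rows_block_free.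
Local Notation onto := (@terwilliger_onto_blocks F).
Local Notation bound := dim_terwilliger_blocks.
Local Notation blk i :=
  (block_product1 terwilliger_has1 rows_free onto bound (Ordinal (isT : (i < 24)%N))).
Local Notation last_blk := (block_product_scalar terwilliger_has1 rows_free onto bound
  (k := Ordinal (isT : (23 < 24)%N)) erefl).
Local Notation "J +| i" := (block_product_pair J (blk i) isT)
  (at level 50, left associativity).

Lemma terwilliger_sym7 : \dim T = 4039%N /\
  alg_isom (subvs_of T)
    ('M[F]_15 * 'M[F]_15 * 'M[F]_26 * 'M[F]_2 *
     'M[F]_17 * 'M[F]_16 * 'M[F]_2 * 'M[F]_21 *
     'M[F]_15 * 'M[F]_2 * 'M[F]_19 * 'M[F]_5 *
     'M[F]_13 * 'M[F]_20 * 'M[F]_8 * 'M[F]_20 *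
     'M[F]_9 * 'M[F]_4 * 'M[F]_9 * 'M[F]_3 *
     'M[F]_3 * 'M[F]_7 * 'M[F]_5 * F^o)%type.
Proof.
split; first by rewrite (matrix_units_basis rows_free onto bound).1 sum_block_dims.
pose J := block_product_pair (blk 0 +| 1 +| 2 +| 3 +| 4 +| 5 +| 6 +| 7 +| 8 +| 9 +| 10
  +| 11 +| 12 +| 13 +| 14 +| 15 +| 16 +| 17 +| 18 +| 19 +| 20 +| 21 +| 22) last_blk isT.
apply: (alg_isom_block_product rows_free onto bound _ J).
move=> k; rewrite -(mem_map val_inj).
by have : val k \in iota 0 24 by rewrite mem_iota ltn_ord.
Qed.

End Final.

Theorem theorem1p1 (R : realType) :
  let T := terwilliger R[i] {perm 'I_7} in
  \dim T = 4039%N /\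
  alg_isom (subvs_of T)
    ('M[R[i]]_15 * 'M[R[i]]_15 * 'M[R[i]]_26 * 'M[R[i]]_2 *
     'M[R[i]]_17 * 'M[R[i]]_16 * 'M[R[i]]_2 * 'M[R[i]]_21 *
     'M[R[i]]_15 * 'M[R[i]]_2 * 'M[R[i]]_19 * 'M[R[i]]_5 *
     'M[R[i]]_13 * 'M[R[i]]_20 * 'M[R[i]]_8 * 'M[R[i]]_20 *
     'M[R[i]]_9 * 'M[R[i]]_4 * 'M[R[i]]_9 * 'M[R[i]]_3 *
     'M[R[i]]_3 * 'M[R[i]]_7 * 'M[R[i]]_5 * R[i]^o)%type.
Proof. exact: terwilliger_sym7. Qed.
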